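(* Let $(W_n)_{n\in\mathbb{N}}$ be an increasing sequence of finite subsets of $\mathbb{Z}^d$ with $\bigcup_{n}W_n=\mathbb{Z}^d$ such that: (i) there exists an increasing sequence of non-negative reals $(r_n)$ with $r_n\to\infty$ and $|(\partial W_n\oplus r_n)\cap W_n|=o(|W_n|)$; (ii) for all $\delta>0$, $\sum_{n}\exp(-\delta|W_n|)<\infty$. Let $\Theta$ be a compact subset of $\mathbb{R}^p$ for some integer $p\ge1$, and let $\{K^\theta,\theta\in\Theta\}$ be a family of translation-invariant DPP kernels on $\mathbb{Z}^d$, $K^\theta(x,y)=K_0^\theta(y-x)$, such that the function $(\theta,x)\mapsto\hat K_0^\theta(x)$ is continuous on $\Theta\times\mathbb{R}^d$. Assume there exist constants $A,\tau>0$ and $M<1$ such that $$\forall\theta\in\Theta,\ \forall x\in\mathbb{Z}^d,\quad |K_0^\theta(x)|\le\frac{A}{1+\|x\|^{d+\tau}},\qquad\text{and}\qquad 0<\hat K_0^\theta(x)\le M\quad \text{for all }\theta\in\Theta \text{ and all } x\in[0,1]^d.$$ Let $\theta^*\in\Theta$ and let $X$ be a DPP on $\mathbb{Z}^d$ with kernel $K^{\theta^*}$. Let $$l_n(\theta|X)=1+\frac{1}{|W_n|}\Big(\log\det(\mathcal{I}_{W_n}-\mathcal{K}^\theta_{W_n})+\log\det\big(L^\theta_{[W_n]}[X\cap W_n]\big)\Big)$$ be the normalized log-likelihood of $X\cap W_n$ and $$\tilde l_n(\theta|X)=1+\int_{[0,1]^d}\log\big(1-\hat K_0^\theta(x)\big)\,dx+\frac{1}{|W_n|}\log\det\big(L_0^\theta[X\cap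 W_n]\big)$$ its approximation. Then, almost surely, $\sup_{\theta\in\Theta}\big|\tilde l_n(\theta|X)-l_n(\theta|X)\big|\to0$ as $n\to\infty$.
   Context: A DPP kernel on $\mathbb{Z}^d$ is a symmetric function $K:\mathbb{Z}^d\times\mathbb{Z}^d\to\mathbb{R}$ whose associated operator $\mathcal{K}$ on $\ell^2(\mathbb{Z}^d)$, $(\mathcal{K}f)(x)=\sum_yK(x,y)f(y)$, has spectrum in $[0,1]$. $X$ is a determinantal point process (DPP) with kernel $K$ if for all $n$ and all distinct $x_1,\dots,x_n\in\mathbb{Z}^d$, $\mathbb{P}(\{x_1,\dots,x_n\}\subset X)=\det(K(x_i,x_j))_{1\le i,j\le n}$. $|W|$ is the cardinality of $W\subset\mathbb{Z}^d$ and $\|\cdot\|$ is the Euclidean norm. $\hat K_0^\theta(x)=\sum_{t\in\mathbb{Z}^d}K_0^\theta(t)e^{-2i\pi\langle t,x\rangle}$, a function on $[0,1]^d$ extended $\mathbb{Z}^d$-periodically to $\mathbb{R}^d$. Define $$L_0^\theta(x)=\int_{[0,1]^d}\frac{\hat K_0^\theta(t)}{1-\hat K_0^\theta(t)}e^{2i\pi\langle t,x\rangle}\,dt,\qquad x\in\mathbb{Z}^d.$$ For $W\subset\mathbb{Z}^d$ finite, $\mathcal{K}_W^\theta$ is the compression of $\mathcal{K}^\theta$ to $\ell^2(W)$, i.e. the matrix $(K^\theta(x,y))_{x,y\in W}$, and $L^\theta_{[W]}$ is the kernel (matrix) of $\mathcal{L}^\theta_{[W]}=\mathcal{K}_W^\theta(\mathcal{I}_W-\mathcal{K}_W^\theta)^{-1}$,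 where $\mathcal{I}_W$ is the identity on $\ell^2(W)$. For a finite set $Y$ and a kernel $F$, $F[Y]=(F(x,y))_{x,y\in Y}$, and $L_0^\theta[Y]=(L_0^\theta(y-x))_{x,y\in Y}$; the determinant of the empty matrix is $1$. For $W\subset\mathbb{Z}^d$, $\partial W$ is the set of points of $W$ having at least one nearest neighbour (at Euclidean distance $1$) in $\mathbb{Z}^d\setminus W$, and $\partial W\oplus r$ is the set of points whose Euclidean distance to $\partial W$ is lower than $r$. *)

(* Defs.v *)
From HB Require Import structures.
From mathcomp Require Import all_boot all_order all_algebra finmap complex.
From mathcomp Require Import all_classical all_reals all_analysis.

Set Implicit Arguments.
Unset Strict Implicit.
Unset Printing Implicit Defensive.

Import Order.TTheory GRing.Theory Num.Theory.
Import numFieldTopology.Exports numFieldNormedType.Exports.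

Local Open Scope classical_set_scope.
Local Open Scope ring_scope.
Local Open Scope complex_scope.

Notation ReC := complex.Re.
Notation ImC := complex.Im.

Section infinite_sums.
Variables (R : realType) (T : choiceType).

(* Unconditional sum of an absolutely summable real family. *)
Definition rsum (f : T -> R) : R :=
  fine (\esum_(x in [set: T]) (EFin \o f)^\+ x)%E
  - fine (\esum_(x in [set: T]) (EFin \o f)^\- x)%E.

Definition csum (f : T -> R[i]) : R[i] :=
  rsum (fun x => ReC (f x)) +i* rsum (fun x => ImC (f x)).

Definition csummable (f : T -> R[i]) : Prop :=
  summable [set: T] (fun x => (Normc.normc (f x))%:E).

Definition l2 (f : T -> R[i]) : Prop :=
  (\esum_(x in [set: T]) ((Normc.normc (f x)) ^+ 2)%:E < +oo)%E.

Definition l2norm (f : T -> R[i]) : R :=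
  Num.sqrt (fine (\esum_(x in [set: T]) ((Normc.normc (f x)) ^+ 2)%:E)).

Definition kernel_op (K : T -> T -> R) (f : T -> R[i]) : T -> R[i] :=
  fun x => csum (fun y => (K x y)%:C * f y).

Definition l2_bounded_kernel (K : T -> T -> R) : Prop :=
  exists C : R, forall f, l2 f ->
    [/\ forall x, csummable (fun y => (K x y)%:C * f y),
        l2 (kernel_op K f)
      & l2norm (kernel_op K f) <= C * l2norm f].

(* z is in the resolvent set when z - K has a bounded two-sided inverse S on
   complex l^2. *)
Definition resolvent_set (K : T -> T -> R) : set R[i] :=
  [set z | exists (S : (T -> R[i]) -> T -> R[i]) (C : R), forall f, l2 f ->
    [/\ l2 (S f),
        l2norm (S f) <= C * l2norm f,
        S (fun x => z * f x - kernel_op K f x) = f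
      & (fun x => z * S f x - kernel_op K (S f) x) = f]].

Definition spectrum (K : T -> T -> R) : set R[i] := ~` resolvent_set K.

(* In R[i], 0 <= z <= 1 forces z to be real. *)
Definition dpp_kernel (K : T -> T -> R) : Prop :=
  [/\ forall x y, K x y = K y x,
      l2_bounded_kernel K
    & spectrum K `<=` [set z | 0 <= z <= 1]].

End infinite_sums.

Section finite_windows.
Variables (R : realType) (T : choiceType).

(* F[Y]; the order in which Y is enumerated does not affect determinants. *)
Definition submat (F : T -> T -> R) (Y : {fset T}) : 'M[R]_#|` Y| :=
  \matrix_(i, j) F (tnth (in_tuple (enum_fset Y)) i)
                   (tnth (in_tuple (enum_fset Y)) j).

(* The kernel on W whose matrix is A, with value 0 outside W x W. *)
Definition mat_kernel (W : {fset T}) (A : 'M[R]_#|` W|) : T -> T -> R :=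
  fun x y => match insub (index x (enum_fset W)), insub (index y (enum_fset W))
             with Some i, Some j => A i j | _, _ => 0 end.

Definition L_window (K : T -> T -> R) (W : {fset T}) : T -> T -> R :=
  mat_kernel (submat K W *m invmx (1%:M - submat K W)).

Definition window (A : set T) (W : {fset T}) : {fset T} :=
  [fset x in W | `[< A x >]]%fset.

Definition is_dpp (disp : measure_display) (Omega : measurableType disp)
    (P : probability Omega R) (X : Omega -> set T) (K : T -> T -> R) : Prop :=
  (forall x, measurable [set w | X w x]) /\
  (forall (n : nat) (x : 'I_n -> T), injective x ->
     P [set w | forall i, X w (x i)]
     = (\det (\matrix_(i < n, j < n) K (x i) (x j)))%:E).

Definition loglik (K : T -> T -> R) (W : {fset T}) (A : set T) : R :=
  1 + (#|` W|%:R)^-1 *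
      (ln (\det (1%:M - submat K W))
       + ln (\det (submat (L_window K W) (window A W)))).

End finite_windows.

Section lattice.
Variables (R : realType) (d : nat).
Local Notation Zd := 'rV[int]_d.

Definition enorm (x : Zd) : R := Num.sqrt (\sum_(i < d) (x 0 i)%:~R ^+ 2).

Definition dot (t : Zd) (x : 'rV[R]_d) : R := \sum_(i < d) (t 0 i)%:~R * x 0 i.

Definition boundary (W : {fset Zd}) : set Zd :=
  [set x | x \in W /\ exists y : Zd, y \notin W /\ enorm (x - y) = 1].

(* The infimum is taken in \bar R, so nothing is close to the empty set. *)
Definition dilation (A : set Zd) (r : R) : set Zd :=
  [set x | (ereal_inf [set (enorm (x - y))%:E | y in A] < r%:E)%E].

Definition stat_kernel (K0 : Zd -> R) : Zd -> Zd -> R := fun x y => K0 (y - x).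

Definition cis (a : R) : R[i] := cos a +i* sin a.

Definition fourier (K0 : Zd -> R) (x : 'rV[R]_d) : R[i] :=
  csum (fun t => (K0 t)%:C * cis (- 2 * pi * dot t x)).

(* For a symmetric kernel K0 is even, so its Fourier series is real-valued. *)
Definition khat (K0 : Zd -> R) (x : 'rV[R]_d) : R := ReC (fourier K0 x).

Definition unit_cube : set 'rV[R]_d :=
  [set x | forall i : 'I_d, 0 <= x 0 i <= 1].

End lattice.

(* Integral over [0,1]^d as an iterated Lebesgue integral, the first coordinate
   being the outermost one; it is only applied to continuous integrands. *)
Fixpoint cube_integral (R : realType) (d : nat) : ('rV[R]_d -> R) -> R :=
  match d with
  | 0 => fun f => f 0
  | d'.+1 => fun f : 'rV[R]_(1 + d') -> R =>
      \int[@lebesgue_measure R]_(t in `[0, 1])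
        cube_integral (fun x : 'rV[R]_d' => f (row_mx t%:M x))
  end.

Section likelihood.
Variables (R : realType) (d : nat).
Local Notation Zd := 'rV[int]_d.

Definition ccube_integral (f : 'rV[R]_d -> R[i]) : R[i] :=
  cube_integral (fun t => ReC (f t)) +i* cube_integral (fun t => ImC (f t)).

(* The integral is real because khat K0 is even when K0 is. *)
Definition L0 (K0 : Zd -> R) (x : Zd) : R :=
  ReC (ccube_integral (fun t =>
    (khat K0 t / (1 - khat K0 t))%:C * cis (2 * pi * dot x t))).

Definition approx_loglik (K0 : Zd -> R) (W : {fset Zd}) (A : set Zd) : R :=
  1 + cube_integral (fun x => ln (1 - khat K0 x))
    + (#|` W|%:R)^-1 * ln (\det (submat (stat_kernel (L0 K0)) (window A W))).

End likelihood.

(* Main.v *)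
Require Import Defs.
From HB Require Import structures.
From mathcomp Require Import all_boot all_order all_algebra finmap complex.
From mathcomp Require Import all_classical all_reals all_analysis.
From mathcomp Require Import ring lra zify.

(* The estimate is deterministic and uniform over configurations.
   Write b = 1 - khat, T(f) for the Toeplitz matrix on W_n with symbol f, and
   S = T(b)^-1.  Then T(b) = I - K_W, T(1/b) is I plus the matrix of L_0, and
   S is I plus the matrix of L_[W].  By compactness m <= khat <= M with m > 0.
   Diagonalising T(b), with eigenvalues l_i, the tangent inequalities of ln
   and of the inverse give
     0 <= ln det T(b) - n int ln b <= tr (T(b) T(1/b)) - n,
     tr (T(1/b) - S) <= (tr (T(b) T(1/b)) - n) / (1 - M).
   Moreover S - I >= m and T(1/b) >= S, so that on any Y included in W the two
   values of ln det differ by at most tr (T(1/b) - S) / m.  Finally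
   tr (T(b) T(1/b)) - n is bounded by the sum over x in W of the l^1 mass of
   K_0 outside W - x, up to the factor 1 / (1 - M), and this sum is o(|W|),
   uniformly in theta, since a lattice point at distance at least r from the
   boundary of W is at distance at least r from the complement of W. *)

Set Implicit Arguments.
Unset Strict Implicit.
Unset Printing Implicit Defensive.

Import Order.TTheory GRing.Theory Num.Theory.
Import numFieldTopology.Exports numFieldNormedType.Exports.

Local Open Scope classical_set_scope.
Local Open Scope ring_scope.

(** * Spectral resolutions and log-determinants *)

Section spectral_resolution.
Local Open Scope complex_scope.
Variables (R : rcfType) (n : nat).
Implicit Types A B P : 'M[R]_n.

(** The quadratic form v A v^T is written as a trace against the Gram matrix of v, so that rank-one
    matrices, [plane] and [cosmx] are all tested against [A] in the same way. *)
Definition psd A := forall v : 'rV[R]_n, 0 <= \tr (v^T *m v *m A).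

(* The real part of z^* z for the complex row vector z = p.1 + i p.2. *)
Definition plane (p : 'rV[R]_n * 'rV[R]_n) : 'M[R]_n :=
  p.1^T *m p.1 + p.2^T *m p.2.

Lemma plane_psd p A : psd A -> 0 <= \tr (plane p *m A).
Proof. by move=> hA; rewrite mulmxDl mxtraceD addr_ge0. Qed.

Lemma Re_conjM (x y : R[i]) :
  ReC (Num.conj x * y) = ReC x * ReC y + ImC x * ImC y.
Proof. by case: x => a b; case: y => c e /=; ring. Qed.

Lemma real_complexM (x : R) (y : R[i]) :
  x%:C * y = (x * ReC y) +i* (x * ImC y).
Proof. by case: y => a b /=; simpc. Qed.

Lemma Re_sum (I : finType) (F : I -> R[i]) :
  ReC (\sum_i F i) = \sum_i ReC (F i).
Proof. exact: (raddf_sum (@complex.Re R : Rcomplex R -> R)). Qed.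

(** Taken from the complex spectral theorem: the eigenvalues are real, and the real part of each
    complex spectral projector is a [plane]. Such a real part has trace one and is positive, but
    need not be a projector; positivity and the weights are all that later arguments use. *)
Lemma spectral_resolution A : A^T = A ->
  exists (l : 'I_n -> R) (p : 'I_n -> 'rV[R]_n * 'rV[R]_n),
    [/\ A = \sum_i l i *: plane (p i), \sum_i plane (p i) = 1%:M,
        forall i, \tr (plane (p i)) = 1, forall i, l i = \tr (plane (p i) *m A)
      & \det A = \prod_i l i].
Proof.
move=> As.
pose Ac := map_mx (real_complex R) A.
have Ah : Ac \is hermsymmx.
  apply: realsym_hermsym.
    by apply/is_hermitianmxP; rewrite expr0 scale1r map_mx_id // map_trmx As.
  by apply/mxOverP => i j; rewrite mxE complex_real.
have /orthomx_spectralP Aeq := hermitian_normalmx Ah.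
set U := spectralmx Ac in Aeq; set D := spectral_diag Ac in Aeq.
have Uu : U \is unitarymx := spectral_unitarymx _.
have UUt : U *m map_mx Num.conj U^T = 1%:M by apply/unitarymxP.
have UtU : map_mx Num.conj U^T *m U = 1%:M by apply: mulmx1C.
have iU : invmx U = map_mx Num.conj U^T by rewrite invmx_unitary.
have Dreal : forall i, D 0 i = (ReC (D 0 i))%:C.
  by move=> i; rewrite RRe_real //; apply/mxOverP/hermitian_spectral_diag_real.
exists (fun i => ReC (D 0 i)).
exists (fun i => (\row_j ReC (U i j), \row_j ImC (U i j))).
have pE i a b : plane (\row_j ReC (U i j), \row_j ImC (U i j)) a b
    = ReC (Num.conj (U i a) * U i b).
  by rewrite Re_conjM /plane !mxE !big_ord1 !mxE.
split.
- apply/matrixP => a b; rewrite summxE.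
  have := congr1 (fun M : 'M[R[i]]_n => ReC (M a b)) Aeq.
  rewrite mxE /= => ->; rewrite iU mul_mx_diag mxE Re_sum.
  apply: eq_bigr => i _; rewrite [in RHS]mxE pE !mxE Dreal.
  by rewrite mulrAC mulrC real_complexM.
- apply/matrixP => a b; rewrite summxE.
  have := congr1 (fun M : 'M[R[i]]_n => ReC (M a b)) UtU.
  rewrite mxE Re_sum !mxE => h.
  transitivity (ReC ((a == b)%:R : R[i])); last by case: (a == b).
  by rewrite -h; apply: eq_bigr => i _; rewrite pE !mxE.
- move=> i; have := congr1 (fun M : 'M[R[i]]_n => ReC (M i i)) UUt.
  rewrite mxE Re_sum !mxE eqxx /= => <-; rewrite /mxtrace.
  by apply: eq_bigr => j _; rewrite pE !mxE mulrC.
(* Each eigenvalue is read off the diagonal of the conjugated matrix. *)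
- move=> i; have : U *m Ac *m map_mx Num.conj U^T = diag_mx D.
    by rewrite Aeq iU !mulmxA UUt mul1mx -mulmxA UUt mulmx1.
  move/(congr1 (fun M : 'M[R[i]]_n => ReC (M i i))).
  rewrite [in RHS]mxE eqxx mulr1n => <-.
  rewrite mxE Re_sum /mxtrace; under [RHS]eq_bigr do rewrite mxE.
  rewrite exchange_big; apply: eq_bigr => j _.
  rewrite !mxE mulr_suml Re_sum; apply: eq_bigr => k _.
  rewrite pE !mxE -(mulrA (U i k)) mulrCA real_complexM.
  rewrite -[in LHS]As mxE mulrC /=.
  by rewrite [U i k * _]mulrC !Re_conjM [ReC _ * _]mulrC [ImC _ * _]mulrC.
- apply: complexI; rewrite -det_map_mx -/Ac Aeq !det_mulmx det_inv mulrAC mulVr.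
    rewrite mul1r det_diag rmorph_prod; apply: eq_bigr => i _; exact: Dreal.
  by rewrite -unitmxE unitarymx_unit.
Qed.

End spectral_resolution.

Section logdet.
Variables (R : realType) (n : nat).
Implicit Types A B P : 'M[R]_n.

Lemma mxtrace_sum (I : finType) (F : I -> 'M[R]_n) :
  \tr (\sum_i F i) = \sum_i \tr (F i).
Proof. exact: raddf_sum. Qed.

Lemma mxtraceB k (A B : 'M[R]_k) : \tr (A - B) = \tr A - \tr B.
Proof. exact: raddfB. Qed.

Lemma trqf A (v : 'rV[R]_n) : \tr (v^T *m v *m A) = \tr (v *m A *m v^T).
Proof. by rewrite -mulmxA mxtrace_mulC. Qed.

Lemma tr_tr_ge0 (v : 'rV[R]_n) : 0 <= \tr (v *m v^T).
Proof.
rewrite /mxtrace big_ord1 mxE sumr_ge0 // => i _.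
by rewrite mxE -expr2 sqr_ge0.
Qed.

Lemma psd_gram (v : 'rV[R]_n) : psd (v^T *m v).
Proof.
move=> u; rewrite trqf mulmxA -mulmxA -[v *m u^T]trmxK trmx_mul trmxK.
rewrite /mxtrace big_ord1 mxE big_ord1 [X in _ * X]mxE -expr2.
exact: sqr_ge0.
Qed.

Lemma psd_plane p : psd (@plane R n p).
Proof. by move=> u; rewrite mulmxDr mxtraceD addr_ge0 ?psd_gram. Qed.

Lemma psdD A B : psd A -> psd B -> psd (A + B).
Proof. by move=> hA hB v; rewrite mulmxDr mxtraceD addr_ge0. Qed.

Lemma psd_scalar (a : R) : 0 <= a -> psd (a%:M : 'M[R]_n).
Proof.
move=> a0 v; rewrite trqf mul_mx_scalar -scalemxAl mxtraceZ.
by rewrite mulr_ge0 ?tr_tr_ge0.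
Qed.

Lemma tr_plane_scalar p (a : R) :
  \tr (plane p *m a%:M) = a * \tr (@plane R n p).
Proof. by rewrite mul_mx_scalar mxtraceZ. Qed.

Lemma eigen_ge (m : R) A (p : 'rV[R]_n * 'rV[R]_n) :
  psd (A - m%:M) -> \tr (plane p) = 1 -> m <= \tr (plane p *m A).
Proof.
move=> hA hp; rewrite -subr_ge0 -[X in _ - X]mulr1 -hp -tr_plane_scalar.
by rewrite -mxtraceB -mulmxBr plane_psd.
Qed.

(** The tangent inequality of ln at 1, applied to x / y; the comparisons of log-determinants rest on
    it. *)
Lemma lnB_le (x y : R) : 0 < x -> 0 < y -> ln x - ln y <= x / y - 1.
Proof.
move=> x0 y0; rewrite -ln_div ?posrE //.
rewrite -[in leLHS](subrKC 1 (x / y)) le_ln1Dx //.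
by rewrite ltrBrDr addNr divr_gt0.
Qed.

Lemma ln_prod (I : finType) (l : I -> R) : (forall i, 0 < l i) ->
  ln (\prod_i l i) = \sum_i ln (l i).
Proof.
move=> l0.
elim: (index_enum I) => [|i r IH]; first by rewrite !big_nil ln1.
by rewrite !big_cons lnM ?IH ?posrE // prodr_gt0.
Qed.

(** Both bounds average [lnB_le] over pairs of eigenvalues. Taking l / k - 1 and summing over i
    first leaves minus the trace of [B - A] against [plane (q j)], divided by [k j]. Taking k / l -
    1 and summing over j first leaves the trace against [plane (p i)] divided by [l i], where [l i]
    is at least m. *)
Lemma logdet_compare (m : R) A B : 0 < m -> A^T = A -> B^T = B ->
  psd (A - m%:M) -> psd (B - A) ->
  0 <= ln (\det B) - ln (\det A) <= \tr (B - A) / m.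
Proof.
move=> m0 As Bs mA AB.
have mB : psd (B - m%:M) by rewrite -(subrK A B) -addrA; exact: psdD.
have [l [p [Al p1 ptr lE detA]]] := spectral_resolution As.
have [k [q [Bk q1 qtr kE detB]]] := spectral_resolution Bs.
have lm i : m <= l i by rewrite lE; exact: eigen_ge.
have km i : m <= k i by rewrite kE; exact: eigen_ge.
have l0 i : 0 < l i := lt_le_trans m0 (lm i).
have k0 i : 0 < k i := lt_le_trans m0 (km i).
rewrite detA detB !ln_prod //.
pose w i j := \tr (plane (p i) *m plane (q j)).
have w0 i j : 0 <= w i j by apply: plane_psd; exact: psd_plane.
have wr i : \sum_j w i j = 1.
  by rewrite -mxtrace_sum -mulmx_sumr q1 mulmx1 ptr.
have wc j : \sum_i w i j = 1.
  by rewrite -mxtrace_sum -mulmx_suml p1 mul1mx qtr.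
(* The weights w are doubly stochastic, so both log-determinants are averages
   over pairs of eigenvalues. *)
have sl : \sum_i ln (l i) = \sum_i \sum_j w i j * ln (l i).
  by apply: eq_bigr => i _; rewrite -mulr_suml wr mul1r.
have sk : \sum_j ln (k j) = \sum_i \sum_j w i j * ln (k j).
  by rewrite exchange_big; apply: eq_bigr => i _; rewrite -mulr_suml wc mul1r.
have wk i : \sum_j w i j * k j = \tr (plane (p i) *m B).
  rewrite Bk mulmx_sumr mxtrace_sum; apply: eq_bigr => j _.
  by rewrite -scalemxAr mxtraceZ mulrC.
have wl j : \sum_i w i j * l i = \tr (plane (q j) *m A).
  rewrite Al mulmx_sumr mxtrace_sum; apply: eq_bigr => i _.
  by rewrite -scalemxAr mxtraceZ mulrC mxtrace_mulC.
have dk i : \tr (plane (p i) *m (B - A)) = \sum_j w i j * k j - l i.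
  by rewrite mulmxBr mxtraceB -wk -lE.
have dl j : \tr (plane (q j) *m (B - A)) = k j - \sum_i w i j * l i.
  by rewrite mulmxBr mxtraceB -kE wl.
apply/andP; split.
  rewrite -oppr_le0 opprB sl sk -sumrB.
  rewrite (eq_bigr (fun i => \sum_j w i j * (ln (l i) - ln (k j)))); last first.
    by move=> i _; rewrite -sumrB; apply: eq_bigr => j _; rewrite mulrBr.
  rewrite exchange_big; apply: sumr_le0 => j _.
  apply: (@le_trans _ _ (\sum_i w i j * (l i / k j - 1))).
    by apply: ler_sum => i _; rewrite ler_wpM2l // lnB_le.
  rewrite (_ : \sum_i _ = - \tr (plane (q j) *m (B - A)) / k j).
    by rewrite mulNr oppr_le0 divr_ge0 //; [exact: plane_psd|exact: ltW].
  rewrite dl opprB mulrBl divff ?gt_eqF // mulr_suml.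
  rewrite -[X in _ = _ - X](wc j) -sumrB.
  by apply: eq_bigr => i _; rewrite mulrBr mulr1 mulrA.
rewrite sl sk -sumrB.
rewrite (eq_bigr (fun i => \sum_j w i j * (ln (k j) - ln (l i)))); last first.
  by move=> i _; rewrite -sumrB; apply: eq_bigr => j _; rewrite mulrBr.
have -> : \tr (B - A) = \sum_i \tr (plane (p i) *m (B - A)).
  by rewrite -mxtrace_sum -mulmx_suml p1 mul1mx.
rewrite mulr_suml; apply: ler_sum => i _.
apply: (@le_trans _ _ (\sum_j w i j * (k j / l i - 1))).
  by apply: ler_sum => j _; rewrite ler_wpM2l // lnB_le.
rewrite (_ : \sum_j _ = \tr (plane (p i) *m (B - A)) / l i).
  by rewrite ler_wpM2l ?plane_psd // lef_pV2 ?posrE.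
rewrite dk mulrBl divff ?gt_eqF // mulr_suml -[X in _ = _ - X](wr i) -sumrB.
by apply: eq_bigr => j _; rewrite mulrBr mulr1 mulrA.
Qed.

(* Positivity of A at s v - v A^-1. *)
Lemma invmx_variational (s : R) A (v : 'rV[R]_n) :
  A^T = A -> A \in unitmx -> psd A ->
  2 * s * \tr (v^T *m v) - s ^+ 2 * \tr (v^T *m v *m A)
  <= \tr (v^T *m v *m invmx A).
Proof.
move=> As Au hA; have := hA (s *: v - v *m invmx A).
rewrite !trqf linearB /= trmx_mul trmx_inv As linearZ /=.
rewrite !mulmxBl !mulmxBr !mxtraceB.
rewrite -?scalemxAl -?scalemxAr -?scalemxAl -?scalemxAr.
rewrite !mulmxA (mulmxKV Au) (mulmxK Au) !mxtraceZ (mxtrace_mulC v^T v).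
by set x := \tr (v *m v^T); lra.
Qed.

Lemma plane_variational (s : R) A p :
  A^T = A -> A \in unitmx -> psd A ->
  2 * s * \tr (@plane R n p) - s ^+ 2 * \tr (plane p *m A)
  <= \tr (plane p *m invmx A).
Proof.
move=> As Au hA; rewrite !mulmxDl !mxtraceD !mulrDr opprD addrACA.
by rewrite lerD // invmx_variational.
Qed.

End logdet.

(** * Iterated integrals over the unit cube *)

Section continuous_real.
Variables (R : realType) (T : topologicalType).
Implicit Types f g : T -> R.

Lemma continuous_real_cst (r : R) : continuous (fun _ : T => r).
Proof. by move=> x; exact: cvg_cst. Qed.

Lemma continuous_realD f g :
  continuous f -> continuous g -> continuous (fun x => f x + g x).
Proof. by move=> cf cg x; apply: (@cvgD R R^o); [exact: cf|exact: cg]. Qed.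

Lemma continuous_realB f g :
  continuous f -> continuous g -> continuous (fun x => f x - g x).
Proof. by move=> cf cg x; apply: (@cvgB R R^o); [exact: cf|exact: cg]. Qed.

Lemma continuous_realM f g :
  continuous f -> continuous g -> continuous (fun x => f x * g x).
Proof. by move=> cf cg x; apply: (@cvgM R T); [exact: cf|exact: cg]. Qed.

Lemma continuous_realV f : (forall x, f x != 0) ->
  continuous f -> continuous (fun x => (f x)^-1).
Proof. by move=> f0 cf x; apply: cvgV; [exact: f0|exact: cf]. Qed.

Lemma continuous_real_comp (h : R -> R) f :
  continuous h -> continuous f -> continuous (fun x => h (f x)).
Proof.
by move=> ch cf x; apply: (@continuous_comp _ _ _ f h); [exact: cf|exact: ch].
Qed.

Lemma continuous_real_sum (I : Type) (r : seq I) (P : pred I)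
    (F : I -> T -> R) :
  (forall i, continuous (F i)) ->
  continuous (fun x => \sum_(i <- r | P i) F i x).
Proof.
move=> cF; elim: r => [|i r IH].
  rewrite (_ : (fun x => _) = fun=> 0); first exact: continuous_real_cst.
  by apply/funext => x; rewrite big_nil.
case Pi: (P i); last first.
  rewrite (_ : (fun x => _) = fun x => \sum_(j <- r | P j) F j x) //.
  by apply/funext => x; rewrite big_cons Pi.
rewrite (_ : (fun x => _) = fun x => F i x + \sum_(j <- r | P j) F j x).
  exact: continuous_realD.
by apply/funext => x; rewrite big_cons Pi.
Qed.

End continuous_real.

(** * Integrals over [0,1] and their dependence on a parameter *)

Section interval_integral.
Variable R : realType.
Local Notation mu := (@lebesgue_measure R).
Local Notation Iab := (`[(0:R), 1]%classic).

Lemma continuous_integrable01 (f : R -> R) :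
  continuous f -> mu.-integrable Iab (EFin \o f).
Proof.
move=> cf; apply: continuous_compact_integrable; first exact: segment_compact.
exact: continuous_subspaceT.
Qed.

Lemma Rintegral01_cst (r : R) : \int[mu]_(t in Iab) r = r.
Proof.
rewrite Rintegral_cst // (_ : fine _ = 1) ?mulr1 //.
have /= -> := lebesgue_measure_itv `[(0 : R), 1].
by rewrite lte_fin ltr01 oppr0 adde0.
Qed.

Lemma Rintegral01_close (f g : R -> R) (e : R) : continuous f -> continuous g ->
  (forall t, Iab t -> `|f t - g t| <= e) ->
  `|\int[mu]_(t in Iab) f t - \int[mu]_(t in Iab) g t| <= e.
Proof.
move=> cf cg fg.
have cfg : continuous (fun t => f t - g t).
  by move=> t; apply: (@continuousB R R^o R f g); [exact: cf|exact: cg].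
rewrite -RintegralB //; [|exact: continuous_integrable01..].
apply: le_trans (le_normr_Rintegral _ (continuous_integrable01 cfg)) _ => //.
rewrite -[leRHS]Rintegral01_cst; apply: le_Rintegral => //.
- apply: continuous_integrable01 => t.
  by apply: cvg_norm; exact: cfg.
- by apply: continuous_integrable01 => t; exact: cvg_cst.
Qed.

Lemma continuous_pair (T U V : topologicalType) (f : T -> U) (g : T -> V) :
  continuous f -> continuous g -> continuous (fun x => (f x, g x)).
Proof. by move=> cf cg x; apply: cvg_pair; [exact: cf|exact: cg]. Qed.

Lemma continuous_section (U V W : topologicalType) (J : U -> V -> W) u :
  continuous (fun z : U * V => J z.1 z.2) -> continuous (J u).
Proof.
move=> cJ v.
apply: (@continuous_comp _ _ _ (fun v : V => (u, v)) (fun z => J z.1 z.2)).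
  by apply: cvg_pair; [exact: cvg_cst|exact: cvg_id].
exact: cJ.
Qed.

(** Joint continuity becomes uniform in t by compactness of [0,1], in its near-covering form; a
    uniform bound on the integrands then bounds the integrals. *)
Lemma Rintegral01_continuous (U : topologicalType) (J : U -> R -> R) :
  continuous (fun z : U * R => J z.1 z.2) ->
  continuous (fun u => \int[mu]_(t in Iab) J u t).
Proof.
move=> cJ u; apply/cvgrPdist_le => e e0.
have /compact_near_coveringP cov : compact Iab by exact: segment_compact.
have Jcont v : continuous (J v) by exact: continuous_section.
have : \forall v \near u, Iab `<=` [set t | `|J u t - J v t| <= e].
  apply: cov => t _.
  have e2 : 0 < e / 2 by rewrite divr_gt0.
  have /cvgrPdist_le/(_ _ e2) [[A B] /= [uA tB] AB] := cJ (u, t).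
  exists (B, A) => //= -[t' v] /= [Bt' Av].
  have h1 := AB (v, t') (conj Av Bt').
  have h2 := AB (u, t') (conj (nbhs_singleton uA) Bt').
  rewrite /= in h1 h2.
  rewrite -(subrKA (J u t)) [leRHS]splitr.
  by apply: le_trans (ler_normD _ _) _; rewrite lerD // distrC.
by apply: filterS => v hv; apply: Rintegral01_close.
Qed.

End interval_integral.

Section cube_integral.
Variable R : realType.
Local Notation mu := (@lebesgue_measure R).

Lemma continuous_row_mx d :
  continuous (fun z : R * 'rV[R]_d => row_mx z.1%:M z.2 : 'rV[R]_(1 + d)).
Proof.
move=> [t x] A [P /= P_nbhs PA].
exists (P 0 (lshift d 0),
  [set y : 'rV[R]_d | forall j, P 0 (rshift 1 j) (y 0 j)]).
  split=> /=; first by have := P_nbhs 0 (lshift d 0); rewrite row_mxEl mxE.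
  exists (fun i j => P 0 (rshift 1 j)) => [i j|y Py j]; last exact: Py.
  by have := P_nbhs 0 (rshift 1 j); rewrite row_mxEr ord1.
move=> [t' y] /= [Pt Py]; apply: PA => i j; rewrite ord1.
by case: (split_ordP j) => k ->; rewrite ?row_mxEl ?row_mxEr // ord1 mxE.
Qed.

Lemma continuous_comp_row_mx (T : topologicalType) d
    (f : T -> R) (g : T -> 'rV[R]_d) : continuous f -> continuous g ->
  continuous (fun x => row_mx (f x)%:M (g x) : 'rV[R]_(1 + d)).
Proof.
move=> cf cg x.
apply: (@continuous_comp _ _ _ (fun x => (f x, g x))
  (fun z => row_mx z.1%:M z.2 : 'rV[R]_(1 + d))); last exact: continuous_row_mx.
exact: continuous_pair.
Qed.

(** The parameter space is arbitrary so that the induction on d can move the outermost coordinate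
    into it, replacing [U] by [U * R]. *)
Lemma cube_integral_param (U : topologicalType) d (f : U -> 'rV[R]_d -> R) :
  continuous (fun z : U * 'rV[R]_d => f z.1 z.2) ->
  continuous (fun u => cube_integral (f u)).
Proof.
elim: d U f => [|d IH] U f cf /=.
  move=> u; apply: (@continuous_comp _ _ _ (fun v : U => (v, 0 : 'rV[R]_0))
    (fun z => f z.1 z.2)); last exact: cf.
  by apply: continuous_pair => v; [exact: cvg_id|exact: cvg_cst].
apply: Rintegral01_continuous.
apply: (IH (U * R)%type (fun z x => f z.1 (row_mx z.2%:M x))) => -[[u t] x].
apply: (@continuous_comp _ _ _
  (fun z : (U * R) * 'rV[R]_d => (z.1.1, row_mx z.1.2%:M z.2 : 'rV[R]_(1 + d)))
  (fun z => f z.1 z.2)); last exact: cf.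
apply: continuous_pair => {u t x} [[[u t] x]|].
  apply: (@continuous_comp _ _ _ (fun z : (U * R) * 'rV[R]_d => z.1) fst);
    exact: cvg_fst.
apply: continuous_comp_row_mx.
  move=> [[u t] x].
  apply: (@continuous_comp _ _ _ (fun z : (U * R) * 'rV[R]_d => z.1) snd).
    exact: cvg_fst.
  exact: cvg_snd.
by move=> z; exact: cvg_snd.
Qed.

Lemma cube_slice d (f : 'rV[R]_d.+1 -> R) : continuous f ->
  continuous (fun z : R * 'rV[R]_d => f (row_mx z.1%:M z.2)).
Proof.
move=> cf z; apply: (@continuous_comp _ _ _
  (fun z : R * 'rV[R]_d => row_mx z.1%:M z.2 : 'rV[R]_(1 + d)) f).
  exact: continuous_row_mx.
exact: cf.
Qed.

Lemma cube_slice1 d (f : 'rV[R]_d.+1 -> R) t : continuous f ->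
  continuous (fun x : 'rV[R]_d => f (row_mx t%:M x)).
Proof.
move=> /cube_slice cf.
exact: (@continuous_section _ _ _
  (fun t (x : 'rV[R]_d) => f (row_mx t%:M x)) t cf).
Qed.

Lemma cube_slice_integrable d (f : 'rV[R]_d.+1 -> R) : continuous f ->
  mu.-integrable `[(0 : R), 1]%classic
    (EFin \o (fun t => cube_integral (fun x : 'rV[R]_d => f (row_mx t%:M x)))).
Proof.
move=> /cube_slice cf; apply: continuous_integrable01.
exact: (@cube_integral_param R d (fun t x => f (row_mx t%:M x))).
Qed.

Lemma cube_integral_cst d (r : R) : cube_integral (fun _ : 'rV[R]_d => r) = r.
Proof. by elim: d => //= d ->; exact: Rintegral01_cst. Qed.

Lemma cube_integral_ext d (f g : 'rV[R]_d -> R) : f =1 g ->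
  cube_integral f = cube_integral g.
Proof. by move=> /funext ->. Qed.

Lemma cube_integralD d (f g : 'rV[R]_d -> R) : continuous f -> continuous g ->
  cube_integral (fun x => f x + g x) = cube_integral f + cube_integral g.
Proof.
elim: d f g => [//|d IH] f g cf cg /=.
rewrite -RintegralD //; [|exact: cube_slice_integrable..].
by apply: eq_Rintegral => t _; rewrite IH //; exact: cube_slice1.
Qed.

Lemma cube_integralZ d (r : R) (f : 'rV[R]_d -> R) : continuous f ->
  cube_integral (fun x => r * f x) = r * cube_integral f.
Proof.
elim: d f => [//|d IH] f cf /=.
rewrite -RintegralZl //; last exact: cube_slice_integrable.
by apply: eq_Rintegral => t _; rewrite IH //; exact: cube_slice1.
Qed.

Lemma cube_integralB d (f g : 'rV[R]_d -> R) : continuous f -> continuous g ->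
  cube_integral (fun x => f x - g x) = cube_integral f - cube_integral g.
Proof.
move=> cf cg; apply: (canRL (addrK _)); rewrite -cube_integralD //.
  by apply: cube_integral_ext => x; rewrite subrK.
exact: continuous_realB.
Qed.

Lemma cube_integral_sum (I : Type) (r : seq I) d (F : I -> 'rV[R]_d -> R) :
  (forall i, continuous (F i)) ->
  cube_integral (fun x => \sum_(i <- r) F i x)
  = \sum_(i <- r) cube_integral (F i).
Proof.
move=> cF; elim: r => [|i r IH].
  rewrite big_nil -[RHS](cube_integral_cst d).
  by apply: cube_integral_ext => x; rewrite big_nil.
rewrite big_cons -IH -cube_integralD //; last exact: continuous_real_sum.
by apply: cube_integral_ext => x; rewrite big_cons.
Qed.

Lemma le_cube_integral d (f g : 'rV[R]_d -> R) : continuous f -> continuous g ->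
  (forall x, f x <= g x) -> cube_integral f <= cube_integral g.
Proof.
elim: d f g => [|d IH] f g cf cg fg /=; first exact: fg.
pose h (k : 'rV[R]_d.+1 -> R) t :=
  cube_integral (fun x : 'rV[R]_d => k (row_mx t%:M x)).
apply: (@le_Rintegral _ _ _ mu _ (h f) (h g)) => //.
- exact: cube_slice_integrable.
- exact: cube_slice_integrable.
move=> t _; apply: IH => [||x]; [exact: cube_slice1..|exact: fg].
Qed.

End cube_integral.

(** * Orthogonality of the characters of the torus *)

Section characters.
Variable R : realType.
Local Notation mu := (@lebesgue_measure R).

Lemma cos2piDint (a : R) (k : int) : cos (2 * pi * k%:~R + a) = cos a.
Proof.
have nat_case b n : cos (2 * pi * n%:R + b) = cos b :> R.
  rewrite -(periodicn (@cosD2pi R) n b); congr cos.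
  by rewrite addrC -mulr_natl mulrC mulr2n -mulr_natl; congr (_ + _); ring.
case: k => n; first exact: nat_case.
by rewrite NegzE rmorphN /= -(nat_case (_ + a) n.+1); congr cos; ring.
Qed.

Lemma sin2piDint (a : R) (k : int) : sin (2 * pi * k%:~R + a) = sin a.
Proof.
have h x : sin x = - cos (x + pi / 2).
  by rewrite cosD cos_pihalf sin_pihalf; ring.
by rewrite !h -addrA cos2piDint.
Qed.

Lemma continuous_dot d (z : 'rV[int]_d) : continuous (@dot R d z).
Proof.
apply: continuous_real_sum => i.
apply: continuous_realM; first exact: continuous_real_cst.
exact: coord_continuous.
Qed.

Lemma dot_row_mx d (z : 'rV[int]_(1 + d)) t (x : 'rV[R]_d) :
  dot z (row_mx t%:M x) = (z 0 0)%:~R * t + dot (rsubmx z) x.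
Proof.
rewrite /dot big_split_ord big_ord1 row_mxEl mxE eqxx mulr1n; congr (_ * _ + _).
  by congr ((z _ _)%:~R); exact: val_inj.
by apply: eq_bigr => i _; rewrite row_mxEr mxE.
Qed.

(** For nonzero k the primitive sin (2 pi k t + a) / (2 pi k) takes the same value at 0 and 1 by
    periodicity. *)
Lemma Rintegral_cos (k : int) (a : R) :
  \int[mu]_(t in `[0, 1]) cos (2 * pi * (k%:~R * t) + a) = (k == 0)%:R * cos a.
Proof.
have [->|k0] := eqVneq k 0.
  rewrite mul1r -[RHS]Rintegral01_cst; apply: eq_Rintegral => t _.
  by rewrite mul0r mulr0 add0r.
rewrite mul0r.
pose c : R := 2 * pi * k%:~R.
have c0 : c != 0 by rewrite !mulf_neq0 ?intr_eq0 // gt_eqF // pi_gt0.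
pose F t := c^-1 * sin (c * t + a).
have dF (t : R) : is_derive t 1 F (cos (c * t + a)).
  have dl : is_derive t 1 (fun t : R => c * t + a) (c * 1 + 0).
    exact: (is_deriveD (is_deriveZ c (is_derive_id _ _)) (is_derive_cst _ _ _)).
  have := is_deriveZ c^-1
    (@is_derive1_comp R (@sin R) (fun t => c * t + a) _ _ _
    (is_derive_sin (c * t + a)) dl).
  move=> h; apply: (is_derive_eq h).
  by rewrite addr0 mulr1 /GRing.scale /= mulrCA mulVf ?mulr1.
have cF : continuous F.
  apply: continuous_realM; first exact: continuous_real_cst.
  apply: continuous_real_comp; first exact: continuous_sin.
  apply: continuous_realD; last exact: continuous_real_cst.
  apply: continuous_realM; first exact: continuous_real_cst.
  by move=> t; exact: cvg_id.
have cc : continuous (fun t => cos (c * t + a)).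
  apply: continuous_real_comp; first exact: continuous_cos.
  apply: continuous_realD; last exact: continuous_real_cst.
  apply: continuous_realM; first exact: continuous_real_cst.
  by move=> t; exact: cvg_id.
rewrite (_ : \int[mu]_(t in _) _ = F 1 - F 0).
  by rewrite /F mulr1 mulr0 add0r sin2piDint subrr.
rewrite /Rintegral.
under eq_integral do rewrite mulrA -/c.
rewrite (@continuous_FTC2 R _ F 0 1 ltr01) //.
- exact: continuous_subspaceT.
- split=> [t _||]; first exact: (@ex_derive _ _ _ _ _ _ _ (dF t)).
  + exact/cvg_at_right_filter/cF.
  + exact/cvg_at_left_filter/cF.
- by move=> t _; rewrite derive1E; exact: derive_val.
Qed.

(* The phase a lets the induction on d avoid a companion sine statement. *)
Lemma cube_integral_cos d (z : 'rV[int]_d) (a : R) :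
  cube_integral (fun x => cos (2 * pi * dot z x + a)) = (z == 0)%:R * cos a.
Proof.
elim: d z a => [|d IH] z a.
  by rewrite /= [z]thinmx0 eqxx mul1r /dot big_ord0 mulr0 add0r.
transitivity (\int[mu]_(t in `[0, 1]) ((rsubmx (z : 'rV_(1 + d)) == 0)%:R *
    cos (2 * pi * ((z 0 0)%:~R * t) + a))).
  apply: eq_Rintegral => t _; rewrite -IH; apply: cube_integral_ext => x.
  by rewrite dot_row_mx; congr cos; ring.
rewrite RintegralZl //; last first.
  apply: continuous_integrable01.
  apply: continuous_real_comp; first exact: continuous_cos.
  apply: continuous_realD; last exact: continuous_real_cst.
  apply: continuous_realM; first exact: continuous_real_cst.
  apply: continuous_realM; first exact: continuous_real_cst.
  by move=> t; exact: cvg_id.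
rewrite Rintegral_cos mulrA -natrM mulnb; congr (_%:R * _).
congr nat_of_bool; apply/andP/eqP => [[/eqP z1 /eqP z0]|->]; last first.
  by split; [apply/eqP/rowP => i; rewrite !mxE|rewrite mxE].
apply/rowP => i; rewrite mxE; case: (split_ordP (i : 'I_(1 + d))) => k ->.
  by rewrite -[RHS]z0; congr (z _ _); apply: val_inj; rewrite /= ord1.
by have /rowP/(_ k) := z1; rewrite !mxE.
Qed.

End characters.

(** * Toeplitz matrices *)

Section toeplitz.
Variables (R : realType) (d n : nat) (x : 'I_n -> 'rV[int]_d).
Implicit Types (f g : 'rV[R]_d -> R) (t : 'rV[R]_d) (P : 'M[R]_n).

Definition cosmx t : 'M[R]_n :=
  \matrix_(i, j) cos (2 * pi * dot (x i - x j) t).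

(** The integral of [f t] times [cosmx t]. For an even symbol the cosine integral is the Fourier
    coefficient, so this is the Toeplitz operator of symbol [f] compressed to the points [x i]. *)
Definition toep f : 'M[R]_n :=
  \matrix_(i, j)
    cube_integral (fun t => f t * cos (2 * pi * dot (x i - x j) t)).

Lemma dotB (z w : 'rV[int]_d) t : dot (z - w) t = dot z t - dot w t.
Proof.
by rewrite /dot -sumrB; apply: eq_bigr => i _; rewrite !mxE rmorphB mulrBl.
Qed.

Lemma dotN (z : 'rV[int]_d) t : dot (- z) t = - dot z t.
Proof.
by rewrite /dot -sumrN; apply: eq_bigr => i _; rewrite !mxE rmorphN mulNr.
Qed.

Lemma continuous_cos_dot (z : 'rV[int]_d) :
  continuous (fun t : 'rV[R]_d => cos (2 * pi * dot z t)).
Proof.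
apply: continuous_real_comp; first exact: continuous_cos.
by apply: continuous_realM; [exact: continuous_real_cst|exact: continuous_dot].
Qed.

Lemma cosmx_plane t : cosmx t =
  plane (\row_i cos (2 * pi * dot (x i) t), \row_i sin (2 * pi * dot (x i) t)).
Proof.
apply/matrixP => i j; rewrite /plane !mxE !big_ord1 !mxE.
by rewrite dotB mulrBr cosB.
Qed.

Lemma psd_cosmx t : psd (cosmx t).
Proof. by rewrite cosmx_plane; exact: psd_plane. Qed.

Lemma tr_cosmx t : \tr (cosmx t) = n%:R.
Proof.
rewrite /mxtrace (eq_bigr (fun=> 1)) ?sumr_const ?card_ord // => i _.
by rewrite mxE subrr /dot big1 ?mulr0 ?cos0 // => j _; rewrite mxE mul0r.
Qed.

Lemma continuous_tr_cosmx P : continuous (fun t => \tr (P *m cosmx t)).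
Proof.
apply: continuous_real_sum => i.
rewrite (_ : (fun t => _) =
  fun t => \sum_j P i j * cos (2 * pi * dot (x j - x i) t)).
  apply: continuous_real_sum => j; apply: continuous_realM.
    exact: continuous_real_cst.
  exact: continuous_cos_dot.
by apply/funext => t; rewrite mxE; apply: eq_bigr => j _; rewrite !mxE.
Qed.

(** Turns pointwise inequalities between symbols into trace inequalities: when [P] is nonnegative
    against every [cosmx t], the right-hand side is the integral of [f] against a nonnegative
    weight. *)
Lemma tr_toep P f : continuous f ->
  \tr (P *m toep f) = cube_integral (fun t => f t * \tr (P *m cosmx t)).
Proof.
move=> cf.
transitivity (cube_integral (fun t =>
    \sum_i \sum_j P i j * (f t * cos (2 * pi * dot (x j - x i) t))));
  last first.
  apply: cube_integral_ext => t; rewrite /mxtrace mulr_sumr.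
  apply: eq_bigr => i _; rewrite mxE mulr_sumr; apply: eq_bigr => j _.
  by rewrite mxE mulrCA.
have cfc i j : continuous (fun t => f t * cos (2 * pi * dot (x j - x i) t)).
  by apply: continuous_realM => //; exact: continuous_cos_dot.
have cPfc i j :
    continuous (fun t => P i j * (f t * cos (2 * pi * dot (x j - x i) t))).
  by apply: continuous_realM => //; exact: continuous_real_cst.
rewrite cube_integral_sum => [|i]; last exact: continuous_real_sum.
apply: eq_bigr => i _; rewrite cube_integral_sum // mxE.
by apply: eq_bigr => j _; rewrite cube_integralZ // mxE.
Qed.

Lemma toepD f g : continuous f -> continuous g ->
  toep (fun t => f t + g t) = toep f + toep g.
Proof.
move=> cf cg; apply/matrixP => i j; rewrite !mxE -cube_integralD.
- by apply: cube_integral_ext => t; rewrite mulrDl.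
- by apply: continuous_realM => //; exact: continuous_cos_dot.
- by apply: continuous_realM => //; exact: continuous_cos_dot.
Qed.

Lemma toepZ (r : R) f : continuous f -> toep (fun t => r * f t) = r *: toep f.
Proof.
move=> cf; apply/matrixP => i j; rewrite !mxE -cube_integralZ.
  by apply: cube_integral_ext => t; rewrite mulrA.
by apply: continuous_realM => //; exact: continuous_cos_dot.
Qed.

Lemma toep_sym f : (toep f)^T = toep f.
Proof.
apply/matrixP => i j; rewrite !mxE; apply: cube_integral_ext => t.
by rewrite -opprB dotN mulrN cosN.
Qed.

Lemma toep_cst (r : R) : injective x -> toep (fun=> r) = r%:M.
Proof.
move=> xI; apply/matrixP => i j; rewrite !mxE cube_integralZ; last first.
  exact: continuous_cos_dot.
rewrite (_ : cube_integral _ = cube_integral (fun t =>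
    cos (2 * pi * dot (x i - x j) t + 0))).
  by rewrite cube_integral_cos cos0 mulr1 subr_eq0 (inj_eq xI) mulr_natr.
by apply: cube_integral_ext => t; rewrite addr0.
Qed.

Lemma tr_toep_le P f g : (forall t, 0 <= \tr (P *m cosmx t)) ->
  continuous f -> continuous g -> (forall t, f t <= g t) ->
  \tr (P *m toep f) <= \tr (P *m toep g).
Proof.
move=> hP cf cg fg; rewrite !tr_toep //; apply: le_cube_integral.
- by apply: continuous_realM => //; exact: continuous_tr_cosmx.
- by apply: continuous_realM => //; exact: continuous_tr_cosmx.
- by move=> t; rewrite ler_wpM2r.
Qed.

Lemma psd_toepB f g : continuous f -> continuous g -> (forall t, f t <= g t) ->
  psd (toep g - toep f).
Proof.
move=> cf cg fg v; rewrite mulmxBr mxtraceB subr_ge0; apply: tr_toep_le => // t.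
exact: psd_cosmx.
Qed.

Lemma tr_toep1 f : continuous f -> \tr (toep f) = n%:R * cube_integral f.
Proof.
move=> cf; rewrite -[toep f]mul1mx tr_toep // -cube_integralZ //.
by apply: cube_integral_ext => t; rewrite mul1mx tr_cosmx mulrC.
Qed.

(** * Toeplitz matrices of a symbol bounded below by a positive constant *)

Section symbol.
Variables (b : 'rV[R]_d -> R) (beta : R).
Hypotheses (xI : injective x) (cb : continuous b).
Hypotheses (beta0 : 0 < beta) (b_ge : forall t, beta <= b t).

Let c t := (b t)^-1.

Let b0 t : 0 < b t. Proof. exact: lt_le_trans beta0 (b_ge t). Qed.

Let cc : continuous c.
Proof. by apply: continuous_realV => // t; rewrite gt_eqF. Qed.

Let clnb : continuous (fun t => ln (b t)).
Proof.
move=> t; apply: (@continuous_comp _ _ _ b (@ln R)); first exact: cb.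
exact: continuous_ln.
Qed.

Lemma psd_toep_ge : psd (toep b - beta%:M).
Proof.
rewrite -toep_cst //; apply: psd_toepB => //.
exact: continuous_real_cst.
Qed.

(** Serves to evaluate tangent lines: against a [plane] of trace one the weight has total mass one,
    so affine functions of the symbol are averaged exactly. *)
Lemma tr_toep_affine p (u v : R) f : \tr (@plane R n p) = 1 -> continuous f ->
  \tr (plane p *m toep (fun t => u + v * f t))
  = u + v * \tr (plane p *m toep f).
Proof.
move=> ptr cf; have cst r := @continuous_real_cst R 'rV[R]_d r.
rewrite toepD ?toepZ ?toep_cst //; last exact: continuous_realM.
by rewrite mulmxDr mxtraceD tr_plane_scalar ptr mulr1 -scalemxAr mxtraceZ.
Qed.

(** For each eigenvalue [l i], the trace of [plane (p i)] against [cosmx t] is a probability density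
    on the cube under which [b] has mean [l i]. The lower bound is Jensen's inequality for ln,
    through its tangent at [l i]; the upper bound integrates ln l - ln b <= l / b - 1. *)
Lemma szego : 0 <= ln (\det (toep b)) - n%:R * cube_integral (fun t => ln (b t))
  <= \tr (toep b *m toep c) - n%:R.
Proof.
have [l [p [Tl p1 ptr lE dT]]] := spectral_resolution (toep_sym b).
have l0 i : 0 < l i.
  by rewrite lE (lt_le_trans beta0) // eigen_ge //; exact: psd_toep_ge.
have nE : n%:R = \sum_(i < n) (1 : R) by rewrite sumr_const card_ord.
have p0 i t : 0 <= \tr (plane (p i) *m cosmx t).
  by apply: plane_psd; exact: psd_cosmx.
(* The integral of ln b, times n, is the trace of its Toeplitz matrix, which is then split along the
   resolution of the identity. *)
rewrite dT ln_prod // -tr_toep1 // -[toep (fun t => ln _)]mul1mx -p1.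
rewrite mulmx_suml mxtrace_sum.
have cst r := @continuous_real_cst R 'rV[R]_d r.
apply/andP; split.
  rewrite subr_ge0; apply: ler_sum => i _.
  apply: (@le_trans _ _
    (\tr (plane (p i) *m toep (fun t => (ln (l i) - 1) + (l i)^-1 * b t)))).
    apply: tr_toep_le => //.
      by apply: continuous_realD => //; exact: continuous_realM.
    by move=> t; have := lnB_le (b0 t) (l0 i); rewrite mulrC; lra.
  by rewrite tr_toep_affine // -lE mulVf ?gt_eqF // subrK.
rewrite {1}Tl mulmx_suml mxtrace_sum nE -!sumrB; apply: ler_sum => i _.
rewrite -scalemxAl mxtraceZ.
rewrite lerBlDr -lerBlDl.
have -> : ln (l i) - (l i * \tr (plane (p i) *m toep c) - 1)
  = \tr (plane (p i) *m toep (fun t => (ln (l i) + 1) + (- l i) * c t)).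
  by rewrite tr_toep_affine //; ring.
apply: tr_toep_le => //.
  by apply: continuous_realD => //; exact: continuous_realM.
by move=> t; have := lnB_le (l0 i) (b0 t); rewrite mulNr /c; lra.
Qed.

Lemma psd_toep : psd (toep b).
Proof.
rewrite -[toep b](subrK beta%:M); apply: psdD; first exact: psd_toep_ge.
exact/psd_scalar/ltW.
Qed.

Lemma toep_unit : toep b \in unitmx.
Proof.
have [l [p [_ _ ptr lE dT]]] := spectral_resolution (toep_sym b).
rewrite unitmxE dT unitfE; apply/prodf_neq0 => i _.
by rewrite gt_eqF // lE (lt_le_trans beta0) // eigen_ge //; exact: psd_toep_ge.
Qed.

(** Let [g i] be the mean of [c] under the density attached to [l i], minus the inverse of [l i]. It
    is nonnegative by convexity of the inverse, the left-hand side is at most the sum of the [g i],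
    and the defect tr (T(b) T(c)) - n is the sum of the [l i * g i], with each [l i] at least
    [beta]. *)
Lemma tr_toepB_inv :
  \tr (toep c - invmx (toep b)) <= (\tr (toep b *m toep c) - n%:R) / beta.
Proof.
have [l [p [Tl p1 ptr lE dT]]] := spectral_resolution (toep_sym b).
have lb i : beta <= l i by rewrite lE eigen_ge //; exact: psd_toep_ge.
have l0 i : 0 < l i := lt_le_trans beta0 (lb i).
have p0 i t : 0 <= \tr (plane (p i) *m cosmx t).
  by apply: plane_psd; exact: psd_cosmx.
pose g i := \tr (plane (p i) *m toep c) - (l i)^-1.
have cst r := @continuous_real_cst R 'rV[R]_d r.
have g0 i : 0 <= g i.
  rewrite subr_ge0.
  (* The affine symbol is the tangent of the inverse at [l i]; its gap to [c] is [b t] times a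
     square. *)
  apply: (@le_trans _ _ (\tr (plane (p i) *m
      toep (fun t => 2 / l i + (- (l i)^-2) * b t)))).
    rewrite tr_toep_affine // -lE.
    rewrite (_ : 2 / l i + _ = (l i)^-1) //.
    by field; rewrite gt_eqF.
  apply: tr_toep_le => //.
    by apply: continuous_realD => //; exact: continuous_realM.
  move=> t; rewrite -subr_ge0 /c.
  have -> : (b t)^-1 - (2 / l i + - (l i)^-2 * b t)
      = b t * ((b t)^-1 - (l i)^-1) ^+ 2.
    by field; rewrite !gt_eqF.
  by rewrite mulr_ge0 ?sqr_ge0 // ltW.
apply: (@le_trans _ _ (\sum_i g i)).
  rewrite -[toep c - _]mul1mx -p1 mulmx_suml mxtrace_sum.
  apply: ler_sum => i _; rewrite mulmxBr mxtraceB lerB //.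
  (* The value s = 1 / l maximises 2 s - s^2 l, with maximum 1 / l. *)
  apply: le_trans (plane_variational (l i)^-1 (p i) (toep_sym b) toep_unit
    psd_toep).
  rewrite ptr -lE (_ : _ - _ = (l i)^-1) //.
  by field; rewrite gt_eqF.
rewrite {1}Tl mulmx_suml mxtrace_sum.
have -> : n%:R = \sum_(i < n) (1 : R) by rewrite sumr_const card_ord.
rewrite -sumrB mulr_suml; apply: ler_sum => i _.
rewrite ler_pdivlMr // -scalemxAl mxtraceZ.
have -> : l i * \tr (plane (p i) *m toep c) - 1 = g i * l i.
  by rewrite mulrBl mulVf ?gt_eqF // mulrC.
by rewrite ler_wpM2l.
Qed.

(** With w = v T(b)^-1, the quadratic form of [cosmx t] at v - b(t) w, weighted by [c t], is
    nonnegative. Its integral is v T(c) v^T - 2 w v^T + w T(b) w^T, that is v (T(c) - T(b)^-1)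
    v^T. *)
Lemma psd_toepB_inv : psd (toep c - invmx (toep b)).
Proof.
move=> v; set T := toep b; set w := v *m invmx T.
have wT : w^T = invmx T *m v^T by rewrite trmx_mul trmx_inv toep_sym.
pose q t (u u' : 'rV[R]_n) := \tr (u^T *m u' *m cosmx t).
have cq u u' : continuous (fun t => q t u u') by exact: continuous_tr_cosmx.
have cst1 := @continuous_real_cst R 'rV[R]_d 1.
(* The factors 1 give every term the shape handled by [tr_toep], with symbol [c], 1 or [b]. *)
have qE t : c t * q t (v - b t *: w) (v - b t *: w)
    = (c t * q t v v - 1 * q t v w) - (1 * q t w v - b t * q t w w).
  have trE : (v - b t *: w)^T = v^T - b t *: w^T by rewrite linearB linearZ.
  rewrite /q trE.
  rewrite mulmxBr !mulmxBl !mxtraceB.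
  rewrite -?scalemxAl -?scalemxAr -?scalemxAl !mxtraceZ /c.
  by field; rewrite gt_eqF.
have : 0 <= cube_integral (fun t =>
    (c t * q t v v - 1 * q t v w) - (1 * q t w v - b t * q t w w)).
  rewrite -[leLHS](cube_integral_cst d); apply: le_cube_integral.
  - exact: continuous_real_cst.
  - by apply: continuous_realB; apply: continuous_realB;
      exact: continuous_realM.
  - move=> t; rewrite -qE; apply: mulr_ge0; last exact: psd_cosmx.
    by rewrite invr_ge0 ltW.
rewrite !cube_integralB; do ?[by apply: continuous_realM
  | by apply: continuous_realB; exact: continuous_realM].
rewrite -!tr_toep // toep_cst // !mulmx1 -/T mulmxBr mxtraceB.
rewrite ![\tr (w^T *m _)]mxtrace_mulC (mxtrace_mulC v^T w).
rewrite [\tr (w^T *m w *m T)]trqf [\tr (v^T *m v *m invmx T)]trqf.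
have Tu : T \in unitmx by exact: toep_unit.
rewrite wT /w !mulmxA (mulmxKV Tu); lra.
Qed.

(** By the variational bound at s = 1, the inverse dominates 2 - T(b), and T(b) is at most 1 - e. *)
Lemma psd_invmx_toep_ge (e : R) : (forall t, b t <= 1 - e) ->
  psd (invmx (toep b) - (1 + e)%:M).
Proof.
move=> be v; rewrite mulmxBr mxtraceB mul_mx_scalar mxtraceZ subr_ge0.
apply: le_trans (invmx_variational 1 v (toep_sym b) toep_unit psd_toep).
have := psd_toepB cb (@continuous_real_cst R _ (1 - e)) be v.
rewrite toep_cst // mulmxBr mxtraceB mul_mx_scalar mxtraceZ; lra.
Qed.

(** By [tr_toep] the trace is the integral of [c] times the sum over i of the expressions compared
    with [b t] in the hypothesis, while n is the integral of [c] times n b. The difference is then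
    controlled by the [tau i] and by [c <= beta^-1]. *)
Lemma tr_toepM_le (tau : 'I_n -> R) :
  (forall i t, `|b t - \sum_j toep b i j * cos (2 * pi * dot (x j - x i) t)|
    <= tau i) ->
  \tr (toep b *m toep c) - n%:R <= (\sum_i tau i) / beta.
Proof.
move=> btau.
have -> : n%:R = cube_integral (fun t => c t * (n%:R * b t)).
  rewrite -[LHS](cube_integral_cst d); apply: cube_integral_ext => t.
  by rewrite /c mulrCA mulVf ?mulr1 // gt_eqF.
have cst r := @continuous_real_cst R 'rV[R]_d r.
rewrite tr_toep // -cube_integralB; last 2 first.
- by apply: continuous_realM => //; exact: continuous_tr_cosmx.
- by apply: continuous_realM => //; exact: continuous_realM.
rewrite -[leRHS](cube_integral_cst d); apply: le_cube_integral => //.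
  apply: continuous_realB; apply: continuous_realM => //.
    exact: continuous_tr_cosmx.
  exact: continuous_realM.
move=> t; rewrite -mulrBr mulrC.
have cbe : c t <= beta^-1 by rewrite lef_pV2 ?posrE.
have c0 : 0 <= c t by rewrite invr_ge0 ltW.
apply: (@le_trans _ _ ((\sum_i tau i) * c t)).
  rewrite ler_wpM2r //.
  have -> : n%:R * b t = \sum_(i < n) b t.
    by rewrite sumr_const card_ord mulr_natl.
  rewrite -sumrB; apply: ler_sum => i _.
  apply: le_trans (btau i t); rewrite distrC; apply: le_trans (ler_norm _).
  rewrite lerB // mxE; apply: ler_sum => j _.
  by rewrite [cosmx t j i]mxE [toep b i j]mxE.
rewrite ler_wpM2l // sumr_ge0 // => i _.
exact: le_trans (normr_ge0 _) (btau i t).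
Qed.

End symbol.
End toeplitz.

(** * Summable families and Fourier series *)

Lemma ler_sum_subset (R : realType) (T : choiceType) (s s' : seq T)
    (h : T -> R) :
  (forall x, 0 <= h x) -> uniq s -> uniq s' -> {subset s <= s'} ->
  \sum_(x <- s) h x <= \sum_(x <- s') h x.
Proof.
move=> h0 us us' ss'.
have -> : \sum_(x <- s) h x = \sum_(x <- s' | x \in s) h x.
  rewrite -[RHS]big_filter; apply: perm_big; apply: uniq_perm => //.
    exact: filter_uniq.
  by move=> x; rewrite mem_filter; apply/esym/andb_idr/ss'.
by rewrite [leRHS](bigID (mem s)) /= lerDl sumr_ge0.
Qed.

Section rsum_approximation.
Variables (R : realType) (T : choiceType) (g : T -> R).
Hypothesis g0 : forall x, 0 <= g x.
Hypothesis gfin : (\esum_(x in [set: T]) (g x)%:E < +oo)%E.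

(** The mass of [g] outside [F], as [rtailE] shows; in this form monotonicity in [F] only concerns
    finite sums. *)
Definition rtail (F : {fset T}) : R :=
  fine (\esum_(x in [set: T]) (g x)%:E)%E - \sum_(x <- F) g x.

Lemma esum_split (h : T -> R) (F : {fset T}) : (forall x, 0 <= h x) ->
  (\esum_(x in [set: T]) (h x)%:E
   = (\sum_(x <- F) h x)%:E + \esum_(x in ~` [set` F]) (h x)%:E)%E.
Proof.
move=> h0; rewrite (esumID [set` F]) => [|x _]; last by rewrite lee_fin.
rewrite !setTI esum_fset; last 2 first.
- exact: finite_fset.
- by move=> x _; rewrite lee_fin.
by rewrite fsbig_finite ?set_fsetK ?sumEFin //; exact: finite_fset.
Qed.

Lemma esum_fin (h : T -> R) (A : set T) : (forall x, 0 <= h x <= g x) ->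
  (\esum_(x in A) (h x)%:E)%E \is a fin_num.
Proof.
move=> hg; rewrite ge0_fin_numE; last first.
  by apply: esum_ge0 => x _; rewrite lee_fin; case/andP: (hg x).
apply: le_lt_trans gfin.
rewrite [leRHS](esumID A) => [|x _]; last by rewrite lee_fin.
rewrite !setTI -[leLHS]adde0; apply: leeD.
  by apply: le_esum => x _; rewrite lee_fin; case/andP: (hg x).
by apply: esum_ge0 => x _; rewrite lee_fin.
Qed.

Lemma fine_esum_split (h : T -> R) (F : {fset T}) :
  (forall x, 0 <= h x <= g x) ->
  fine (\esum_(x in [set: T]) (h x)%:E)%E
  = \sum_(x <- F) h x + fine (\esum_(x in ~` [set` F]) (h x)%:E)%E.
Proof.
move=> hg; rewrite (@esum_split h F) => [|x]; last by case/andP: (hg x).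
by rewrite fineD // esum_fin.
Qed.

Lemma rtailE F : rtail F = fine (\esum_(x in ~` [set` F]) (g x)%:E)%E.
Proof.
rewrite /rtail (@fine_esum_split g F) => [|x]; last by rewrite g0 lexx.
set a := fine _; set b := \sum_(_ <- _) _.
by rewrite [b + a]addrC addrK.
Qed.

(** The error is the difference of the tails of the positive and negative parts of f. Both are
    nonnegative, and their sum is the tail of |f|, hence at most that of [g]. *)
Lemma rsum_close (f : T -> R) (F : {fset T}) : (forall x, `|f x| <= g x) ->
  `|rsum f - \sum_(x <- F) f x| <= rtail F.
Proof.
move=> fg.
pose p x := Num.max (f x) 0; pose q x := Num.max (- f x) 0.
have pg x : 0 <= p x <= g x.
  by rewrite le_max lexx orbT ge_max g0 andbT (le_trans (ler_norm _)).
have qg x : 0 <= q x <= g x.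
  rewrite le_max lexx orbT ge_max g0 andbT (le_trans (ler_norm _)) //.
  by rewrite normrN.
have [fpq fpqn] : (forall x, f x = p x - q x) /\ (forall x, p x + q x = `|f x|).
  split=> x; rewrite /p /q; have /orP[h|h] := le_total 0 (f x).
  - by rewrite max_l // max_r ?oppr_le0 // subr0.
  - by rewrite max_r // max_l ?oppr_ge0 // sub0r opprK.
  - by rewrite max_l // max_r ?oppr_le0 // addr0 ger0_norm.
  - by rewrite max_r // max_l ?oppr_ge0 // add0r ler0_norm.
have -> : rsum f = fine (\esum_(x in [set: T]) (p x)%:E)%E
                 - fine (\esum_(x in [set: T]) (q x)%:E)%E.
  congr (fine _ - fine _); apply: eq_esum => x _.
    by rewrite /p EFin_max funepos.unlock.
  by rewrite /q EFin_max funeneg.unlock.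
rewrite (fine_esum_split F pg) (fine_esum_split F qg).
set a := fine (esum _ _); set b := fine (esum _ _).
have -> : \sum_(x <- F) f x = \sum_(x <- F) p x - \sum_(x <- F) q x.
  by rewrite -sumrB; apply: eq_bigr => x _; rewrite fpq.
have a0 : 0 <= a.
  by apply/fine_ge0/esum_ge0 => x _; rewrite lee_fin; case/andP: (pg x).
have b0 : 0 <= b.
  by apply/fine_ge0/esum_ge0 => x _; rewrite lee_fin; case/andP: (qg x).
have : a + b <= rtail F.
  rewrite rtailE -fineD ?esum_fin // -esumD; last 2 first.
  - by move=> x _; rewrite lee_fin; case/andP: (pg x).
  - by move=> x _; rewrite lee_fin; case/andP: (qg x).
  apply: fine_le; [| |apply: le_esum => x _; rewrite -EFinD lee_fin fpqn //].
    under eq_esum do rewrite -EFinD.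
    by apply: esum_fin => x; rewrite fpqn fg andbT.
  by apply: esum_fin => x; rewrite g0 lexx.
by rewrite ler_norml; lra.
Qed.

Lemma rtail_ge0 F : 0 <= rtail F.
Proof. by rewrite rtailE; apply/fine_ge0/esum_ge0 => x _; rewrite lee_fin. Qed.

Lemma rtail_le (F F' : {fset T}) : {subset F <= F'} -> rtail F' <= rtail F.
Proof.
by move=> FF'; rewrite lerB // ler_sum_subset.
Qed.

Lemma rtail_small (e : R) : 0 < e -> exists F, rtail F < e.
Proof.
move=> e0.
have fin : (\esum_(x in [set: T]) (g x)%:E)%E \is a fin_num.
  by apply: esum_fin => x; rewrite g0 lexx.
have [_ [A [finA _] <-]] := ub_ereal_sup_adherent e0 fin.
rewrite -/(esum _ _) -(fineK fin) -EFinN -EFinD fsbig_finite // sumEFin lte_fin.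
by move=> h; exists (fset_set A); rewrite /rtail; lra.
Qed.

End rsum_approximation.

(** * The Fourier series of the kernel and its inversion *)

Section fourier_series.
Variables (R : realType) (d : nat) (K0 : 'rV[int]_d -> R).

Lemma khatE (t : 'rV[R]_d) :
  khat K0 t = rsum (fun z => K0 z * cos (2 * pi * dot z t)).
Proof.
rewrite /khat /fourier /csum /=; congr rsum; apply/funext => z /=.
by rewrite mul0r subr0 !mulNr cosN.
Qed.

Lemma khat_periodic (t : 'rV[R]_d) (k : 'rV[int]_d) :
  khat K0 (t + map_mx intr k) = khat K0 t.
Proof.
rewrite !khatE; congr rsum; apply/funext => z; congr (_ * _).
have -> : dot z (t + map_mx intr k) = (\sum_i z 0 i * k 0 i)%:~R + dot z t.
  rewrite /dot rmorph_sum -big_split; apply: eq_bigr => i _.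
  by rewrite !mxE rmorphM /= mulrDr addrC.
by rewrite mulrDr cos2piDint.
Qed.

(** The integral inequalities above compare symbols on the whole space; subtracting integer parts
    brings any point into the cube. *)
Lemma khat_bounds (m M : R) :
  (forall t, unit_cube t -> m <= khat K0 t <= M) ->
  forall t, m <= khat K0 t <= M.
Proof.
move=> h t; pose k := \row_i - Num.floor (t 0 i).
rewrite -(khat_periodic t k); apply: h => i; rewrite !mxE rmorphN /=.
rewrite subr_ge0 floor_le_tmp lerBlDr ltW // addrC.
by have := floorD1_gt (t 0 i); rewrite rmorphD.
Qed.

Variable g : 'rV[int]_d -> R.
Hypothesis gfin : (\esum_(x in [set: 'rV[int]_d]) (g x)%:E < +oo)%E.
Hypothesis K0g : forall z, `|K0 z| <= g z.
Hypothesis K0N : forall z, K0 (- z) = K0 z.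
Hypothesis ck : continuous (@khat R d K0).

Let g0 z : 0 <= g z. Proof. exact: le_trans (normr_ge0 _) (K0g z). Qed.

Lemma khat_close t (F : {fset 'rV[int]_d}) :
  `|khat K0 t - \sum_(z <- F) K0 z * cos (2 * pi * dot z t)| <= rtail g F.
Proof.
rewrite khatE; apply: rsum_close => // z.
rewrite normrM; apply: le_trans (K0g z).
rewrite ler_piMr // ler_norml cos_geN1 cos_le1 //.
Qed.

Lemma cube_integral_close (f h : 'rV[R]_d -> R) (e : R) :
  continuous f -> continuous h -> (forall t, `|f t - h t| <= e) ->
  `|cube_integral f - cube_integral h| <= e.
Proof.
move=> cf ch fh; rewrite -cube_integralB // ler_norml.
have cfh := continuous_realB cf ch.
have cst r := @continuous_real_cst R 'rV[R]_d r.
rewrite -[X in X <= _](cube_integral_cst d).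
rewrite -[X in _ && (_ <= X)](cube_integral_cst d).
by apply/andP; split; apply: le_cube_integral => // t;
  have := fh t; rewrite ler_norml => /andP[].
Qed.

Lemma cube_integral_cos_cos (w z : 'rV[int]_d) :
  cube_integral (fun t => cos (2 * pi * dot w t) * cos (2 * pi * dot z t))
  = ((w == z)%:R + (w == - z)%:R) / 2 :> R.
Proof.
have cc u : continuous (fun t : 'rV[R]_d => cos (2 * pi * dot u t + 0)).
  rewrite (_ : (fun _ => _) = fun t => cos (2 * pi * dot u t)).
    exact: continuous_cos_dot.
  by apply/funext => t; rewrite addr0.
transitivity (cube_integral (fun t : 'rV[R]_d => 2^-1 *
    (cos (2 * pi * dot (w - z) t + 0) + cos (2 * pi * dot (w - - z) t + 0)))).
  apply: cube_integral_ext => t; rewrite !dotB dotN !addr0 opprK.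
  by rewrite [2 * pi * (_ - _)]mulrBr [2 * pi * (_ + _)]mulrDr cosB cosD; field.
rewrite cube_integralZ; last exact: continuous_realD.
rewrite cube_integralD // !cube_integral_cos cos0 !mulr1 !subr_eq0.
by rewrite mulrC.
Qed.

(** Fourier inversion: a finite partial sum containing the relevant frequencies integrates exactly
    to [K0 z], and the remainder is uniformly at most [rtail g F], which is arbitrarily small. *)
Lemma cube_integral_khat_cos z :
  cube_integral (fun t => khat K0 t * cos (2 * pi * dot z t)) = K0 z.
Proof.
apply/eqP; rewrite -subr_eq0 -normr_le0; apply/ler_addgt0Pr => e e0.
rewrite add0r.
have [F0 F0e] := rtail_small g0 gfin e0.
(* The cosine sees both z and -z, each contributing half of [K0 z]; hence both are put into [F]. *)
pose F := (F0 `|` [fset z; - z])%fset.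
have Fe : rtail g F <= e.
  apply: le_trans (ltW F0e); apply: rtail_le => // x xF.
  by rewrite in_fsetU xF.
have zF : z \in F by rewrite !inE eqxx !orbT.
have NzF : - z \in F by rewrite !inE eqxx !orbT.
have cz := @continuous_cos_dot R d z.
have cK w : continuous (fun t : 'rV[R]_d => K0 w * cos (2 * pi * dot w t)).
  apply: continuous_realM; first exact: continuous_real_cst.
  exact: continuous_cos_dot.
have cS : continuous (fun t : 'rV[R]_d =>
    \sum_(w <- F) K0 w * cos (2 * pi * dot w t)).
  exact: continuous_real_sum.
have -> : K0 z = cube_integral (fun t =>
    (\sum_(w <- F) K0 w * cos (2 * pi * dot w t)) * cos (2 * pi * dot z t)).
  rewrite (cube_integral_ext (g := fun t => \sum_(w <- F)
     K0 w * (cos (2 * pi * dot w t) * cos (2 * pi * dot z t)))); last first.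
    by move=> t; rewrite mulr_suml; apply: eq_bigr => w _; rewrite mulrA.
  rewrite cube_integral_sum; last first.
    move=> w; apply: continuous_realM; first exact: continuous_real_cst.
    by apply: continuous_realM => //; exact: continuous_cos_dot.
  under eq_bigr => w _.
    rewrite cube_integralZ; last first.
      by apply: continuous_realM => //; exact: continuous_cos_dot.
    rewrite cube_integral_cos_cos mulrA mulrDr; over.
  have del u : u \in F -> \sum_(w <- F) K0 w * (w == u)%:R = K0 u.
    move=> uF; rewrite (bigD1_seq u) ?fset_uniq //= eqxx mulr1 big1 ?addr0 //.
    by move=> w /negPf ->; rewrite mulr0.
  by rewrite -mulr_suml big_split /= !del // K0N; field.
apply: le_trans Fe; apply: cube_integral_close.
- exact: continuous_realM.
- exact: continuous_realM.
move=> t; rewrite -mulrBl normrM; apply: le_trans (khat_close t F).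
by rewrite ler_piMr // ler_norml cos_geN1 cos_le1.
Qed.

Section window.
Variables (n : nat) (x : 'I_n -> 'rV[int]_d).
Hypothesis xI : injective x.

Lemma toep_khat : toep x (khat K0) = \matrix_(i, j) K0 (x j - x i).
Proof.
apply/matrixP => i j; rewrite !mxE cube_integral_khat_cos.
by rewrite -opprB K0N.
Qed.

Lemma toep_1B_khat :
  toep x (fun t => 1 - khat K0 t) = 1%:M - \matrix_(i, j) K0 (x j - x i).
Proof.
have c1 := @continuous_real_cst R 'rV[R]_d 1.
rewrite -toep_khat -(toep_cst _ xI) -[toep x (khat K0)]scale1r.
apply/eqP; rewrite eq_sym subr_eq; apply/eqP.
rewrite scale1r -toepD //; last exact: continuous_realB.
by congr (toep x); apply/funext => t; rewrite subrK.
Qed.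

(** Row i carries the coefficients [K0 (x j - x i)], so its cosine sum is a partial Fourier sum over
    the window seen from [x i]; the identity matrix accounts for the constant 1. *)
Lemma toep_symbol_close i t :
  `|(1 - khat K0 t) - \sum_j toep x (fun t => 1 - khat K0 t) i j *
      cos (2 * pi * dot (x j - x i) t)|
  <= rtail g [fset x j - x i | j in 'I_n]%fset.
Proof.
rewrite toep_1B_khat.
apply: le_trans (khat_close t [fset x j - x i | j in 'I_n]%fset).
rewrite big_imfset /=; last by move=> j k _ _ /addIr /xI.
rewrite big_enum /=.
under eq_bigr do rewrite !mxE mulrBl.
rewrite sumrB (bigD1 i) //= eqxx mul1r big1 ?addr0; last first.
  by move=> j ji; rewrite eq_sym (negPf ji) mul0r.
rewrite subrr /dot [X in cos (_ * X)]big1 ?mulr0 ?cos0; last first.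
  by move=> j _; rewrite mxE mul0r.
rewrite distrC; set S := \sum_j _.
by rewrite (_ : 1 - S - _ = khat K0 t - S) //; ring.
Qed.

End window.
End fourier_series.

(** * Summability of the decay bound *)

Section decay.
Variable R : realType.

Lemma powR_le (r a b : R) : 0 <= r -> 0 <= a -> a <= b -> a `^ r <= b `^ r.
Proof.
move=> r0 a0 ab; apply: ge0_ler_powR; rewrite ?nnegrE //; exact: le_trans ab.
Qed.

(** With x = k + 2, the claim amounts to 1 + s / x <= (1 - 1/x)^(-s), which follows from exp u >= 1
    + u and ln (1 - 1/x) <= - 1/x. *)
Lemma powR_telescope (s : R) (k : nat) : 0 < s ->
  k.+2%:R `^ (- (1 + s)) <= (k.+1%:R `^ (- s) - k.+2%:R `^ (- s)) / s.
Proof.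
move=> s0; set x : R := k.+2%:R.
have x0 : 0 < x by rewrite ltr0n.
have xE : k.+1%:R = x * (1 - x^-1) :> R.
  by rewrite mulrBr mulr1 divff ?gt_eqF // /x -[k.+2]addn1 natrD addrK.
have u0 : 0 < 1 - x^-1.
  by rewrite subr_gt0 invf_lt1 // ltr1n.
have x0' := ltW x0; have u0' := ltW u0; have s0' := ltW s0.
rewrite ler_pdivlMr // xE powRM // opprD powRD; last first.
  by rewrite (gt_eqF x0) implybT.
rewrite powR_inv1 //.
have h : 1 + s * x^-1 <= (1 - x^-1) `^ (- s).
  rewrite /powR gt_eqF //; apply: le_trans (expR_ge1Dx _).
  rewrite lerD2l mulNr -mulrN ler_wpM2l // lerNr.
  have := @le_ln1Dx R (- x^-1); apply.
  by rewrite ltrNl opprK invf_lt1 // ltr1n.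
rewrite -[X in _ <= _ - X]mulr1 -mulrBr -mulrA mulrCA ler_wpM2l ?powR_ge0 //.
by rewrite lerBrDl [x^-1 * s]mulrC.
Qed.

Lemma sum_powR_le (s : R) (n : nat) : 0 < s ->
  \sum_(k < n) k.+1%:R `^ (- (1 + s)) <= 1 + s^-1.
Proof.
move=> s0.
(* The telescoping remainder is kept in the bound so that the induction closes; m = 0 is an
   equality. *)
have h : forall m, \sum_(k < m.+1) k.+1%:R `^ (- (1 + s))
    <= 1 + s^-1 - m.+1%:R `^ (- s) / s.
  elim=> [|m IH].
    by rewrite big_ord1 !powR1 mul1r addrK.
  rewrite big_ord_recr /=; apply: le_trans (lerD IH (powR_telescope m s0)) _.
  by rewrite mulrBl; lra.
case: n => [|n]; first by rewrite big_ord0 addr_ge0 // invr_ge0 ltW.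
apply: le_trans (h n) _.
by rewrite gerBl mulr_ge0 ?powR_ge0 // invr_ge0 ltW.
Qed.

Variable d : nat.
Local Notation Zd := 'rV[int]_d.

Lemma enorm_ge0 (z : Zd) : 0 <= enorm R z.
Proof. exact: sqrtr_ge0. Qed.

Lemma enorm_coord (z : Zd) i : (absz (z 0 i))%:R <= enorm R z.
Proof.
have -> : (absz (z 0 i))%:R = `|(z 0 i)%:~R| :> R.
  by rewrite -intr_norm -abszE -pmulrn.
rewrite -sqrtr_sqr /enorm ler_sqrt; last first.
  by apply: sumr_ge0 => j _; exact: sqr_ge0.
rewrite (bigD1 i) //= lerDl sumr_ge0 // => j _; exact: sqr_ge0.
Qed.

(** The exponent d + tau is shared equally among the d coordinates. Each gets 1 + tau / d, still
    greater than 1, so that the sum over a box factors into bounded one-dimensional sums. *)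
Lemma decay_le_prod (tau : R) (z : Zd) : (0 < d)%N -> 0 < tau ->
  (1 + enorm R z `^ (d%:R + tau))^-1 <= 2 `^ (d%:R + tau) *
    \prod_i (1 + (absz (z 0 i))%:R) `^ (- (1 + tau / d%:R)).
Proof.
move=> d0 tau0; set p := d%:R + tau; set N := enorm R z.
have dR : 0 < d%:R :> R by rewrite ltr0n.
have N0 : 0 <= N := enorm_ge0 z.
have p0 : 0 < p by rewrite addr_gt0.
have prodE : \prod_(i < d) (1 + N) `^ (1 + tau / d%:R) = (1 + N) `^ p.
  rewrite prodr_const card_ord -powR_mulrn ?powR_ge0 // -powRrM.
  by congr (_ `^ _); rewrite /p; field; rewrite gt_eqF.
have h1 : \prod_i (1 + (absz (z 0 i))%:R) `^ (1 + tau / d%:R) <= (1 + N) `^ p.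
  rewrite -prodE; apply: ler_prod => i _; rewrite powR_ge0 /=.
  apply: powR_le; first by rewrite addr_ge0 // divr_ge0 // ltW.
    by rewrite addr_ge0.
  by rewrite lerD2l enorm_coord.
have h2 : (1 + N) `^ p <= 2 `^ p * (1 + N `^ p).
  have [N1|N1] := lerP N 1.
    apply: (@le_trans _ _ (2 `^ p)).
      by apply: powR_le; [exact: ltW|rewrite addr_ge0|lra].
    by rewrite ler_peMr ?powR_ge0 // lerDl powR_ge0.
  apply: (@le_trans _ _ ((2 * N) `^ p)).
    by apply: powR_le; [exact: ltW|rewrite addr_ge0|lra].
  by rewrite powRM // ler_wpM2l ?powR_ge0 // lerDr.
have P0 : 0 < \prod_i (1 + (absz (z 0 i))%:R) `^ (1 + tau / d%:R).
  by apply: prodr_gt0 => i _; rewrite powR_gt0 // ltr_wpDr.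
have -> : \prod_i (1 + (absz (z 0 i))%:R) `^ (- (1 + tau / d%:R))
    = (\prod_i (1 + (absz (z 0 i))%:R) `^ (1 + tau / d%:R))^-1 :> R.
  by rewrite -prodfV; apply: eq_bigr => i _; rewrite powRN.
rewrite ler_pdivlMr // mulrC ler_pdivrMr; last by rewrite ltr_wpDr ?powR_ge0.
exact: le_trans h1 h2.
Qed.

(** Enumerates the integers from -n to n - 1 without repetition, since [Negz k] is -(k + 1). *)
Definition int_of_pair n (q : bool * 'I_n) : int :=
  if q.1 then Posz q.2 else Negz q.2.

Lemma sum_pair_decay (s : R) n : 0 < s ->
  \sum_(q : bool * 'I_n) (1 + (absz (int_of_pair q))%:R) `^ (- (1 + s))
  <= 2 * (1 + s^-1).
Proof.
move=> s0.
apply: (@le_trans _ _ (\sum_(q : bool * 'I_n) q.2.+1%:R `^ (- (1 + s)))).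
  apply: ler_sum => -[b k] _.
  have q0 : 0 < 1 + (absz (int_of_pair (b, k)))%:R :> R by rewrite ltr_wpDr.
  rewrite !powRN lef_pV2 ?posrE ?powR_gt0 //.
  apply: powR_le => //; first by rewrite addr_ge0 // ltW.
  rewrite -natr1 addrC lerD2l ler_nat.
  by case: (b) => /=; rewrite ?leqnSn.
rewrite -(pair_big xpredT xpredT
  (fun _ (k : 'I_n) => k.+1%:R `^ (- (1 + s)))) /=.
by rewrite big_bool mulr_natl mulr2n lerD // sum_powR_le.
Qed.

(** [F] lies in a box, over which the sum of products is a product of d one-dimensional sums; these
    are bounded independently of the box. *)
Lemma decay_fsum (tau : R) (F : {fset Zd}) : (0 < d)%N -> 0 < tau ->
  \sum_(z <- F) (1 + enorm R z `^ (d%:R + tau))^-1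
  <= 2 `^ (d%:R + tau) * (2 * (1 + (tau / d%:R)^-1)) ^+ d.
Proof.
move=> d0 tau0; set s := tau / d%:R.
have s0 : 0 < s by rewrite divr_gt0 // ltr0n.
pose h (z : Zd) : R := \prod_i (1 + (absz (z 0 i))%:R) `^ (- (1 + s)).
have h0 z : 0 <= h z by apply: prodr_ge0 => i _; exact: powR_ge0.
apply: (@le_trans _ _ (\sum_(z <- F) 2 `^ (d%:R + tau) * h z)).
  by apply: ler_sum => z _; exact: decay_le_prod.
rewrite -mulr_sumr ler_wpM2l ?powR_ge0 //.
pose n := (\max_(z <- F) \max_(i < d) (absz (z 0%R i))).+1.
pose row (f : {ffun 'I_d -> bool * 'I_n}) : Zd := \row_i int_of_pair (f i).
have pI : injective (@int_of_pair n).
  move=> [[] k] [[] k'] //= [] /ord_inj -> //.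
have rowI : injective row.
  move=> f f' /rowP e; apply/ffunP => i; apply: pI.
  by have := e i; rewrite !mxE.
apply: (@le_trans _ _
  (\sum_(z <- map row (enum {ffun 'I_d -> bool * 'I_n})) h z)).
  apply: ler_sum_subset => //.
    by rewrite map_inj_uniq ?enum_uniq.
  move=> z zF.
  have zn i : (absz (z 0%R i) < n)%N.
    rewrite ltnS; apply: leq_trans (leq_bigmax_seq _ zF _) => //.
    exact: (leq_bigmax i).
  have zn' i : ((absz (z 0%R i)).-1 < n)%N.
    by apply: leq_ltn_trans (zn i); exact: leq_pred.
  (* The absolute value of [Negz k] is k + 1, whence the predecessor for negative coordinates. *)
  pose f := [ffun i => if 0 <= z 0 i then (true, Ordinal (zn i))
                       else (false, Ordinal (zn' i))].
  apply/mapP; exists f; first by rewrite mem_enum.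
  apply/rowP => i; rewrite mxE ffunE (fun_if (@int_of_pair n)) /int_of_pair /=.
  by case: (z 0 i).
rewrite big_map big_enum /= /h.
have -> : \sum_f \prod_i (1 + (absz (row f 0 i))%:R) `^ (- (1 + s)) =
    \prod_(i < d) \sum_(q : bool * 'I_n)
      (1 + (absz (int_of_pair q))%:R) `^ (- (1 + s)) :> R.
  rewrite bigA_distr_bigA; apply: eq_bigr => f _; apply: eq_bigr => i _.
  by rewrite mxE.
rewrite prodr_const card_ord lerXn2r ?nnegrE //.
- by apply: sumr_ge0 => q _; exact: powR_ge0.
- by rewrite mulr_ge0 // addr_ge0 // invr_ge0 ltW.
- exact: sum_pair_decay.
Qed.

Lemma decay_summable (A tau : R) : (0 < d)%N -> 0 < A -> 0 < tau ->
  (\esum_(z in [set: Zd]) (A / (1 + enorm R z `^ (d%:R + tau)))%:E < +oo)%E.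
Proof.
move=> d0 A0 tau0.
apply: (@le_lt_trans _ _
  (A * (2 `^ (d%:R + tau) * (2 * (1 + (tau / d%:R)^-1)) ^+ d))%:E); last first.
  exact: ltry.
apply: ge_ereal_sup => _ [X [finX _] <-].
rewrite fsbig_finite // sumEFin lee_fin -mulr_sumr ler_pM2l //.
exact: decay_fsum.
Qed.

End decay.

(** * Lattice boundaries *)

Section boundary.
Variables (R : realType) (d : nat).
Local Notation Zd := 'rV[int]_d.

Lemma enorm_le (z w : Zd) : (forall i, `|z 0 i| <= `|w 0 i|) ->
  enorm R z <= enorm R w.
Proof.
move=> zw; rewrite /enorm ler_sqrt; last first.
  by apply: sumr_ge0 => i _; exact: sqr_ge0.
apply: ler_sum => i _; rewrite -[leLHS]real_normK ?num_real //.
rewrite -[leRHS]real_normK ?num_real // lerXn2r ?nnegrE // -!intr_norm ler_int.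
exact: zw.
Qed.

Lemma enormN (z : Zd) : enorm R (- z) = enorm R z.
Proof.
by congr Num.sqrt; apply: eq_bigr => i _; rewrite mxE rmorphN sqrrN.
Qed.

(** Walk from y towards x by unit steps, by induction on the l^1 distance. No coordinate ever moves
    away from that of x, and the first point of the walk in [W] has its predecessor outside, hence
    is a boundary point. *)
Lemma boundary_exit (W : {fset Zd}) (x y : Zd) : x \in W -> y \notin W ->
  exists2 z, boundary R W z & enorm R (x - z) <= enorm R (x - y).
Proof.
have [n] := ubnP (\sum_i absz (x 0%R i - y 0%R i)%R).
elim: n y => // n IH y; rewrite ltnS => yn xW yW.
have /existsP[i xyi] : [exists i, x 0 i != y 0 i].
  apply: contraNT yW; rewrite negb_exists => /forallP xy.
  suff -> : y = x by [].
  by apply/rowP => i; have := xy i; rewrite negbK => /eqP.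
(* One unit step towards x along a coordinate where x and y differ. *)
pose y' : Zd := \row_j if j == i then y 0 i + Num.sg (x 0 i - y 0 i) else y 0 j.
have y'E j : y' 0 j = if j == i then y 0 i + Num.sg (x 0 i - y 0 i) else y 0 j.
  by rewrite mxE.
have step : (absz (x 0%R i - y' 0%R i)%R < absz (x 0%R i - y 0%R i)%R)%N.
  rewrite y'E eqxx; move: xyi; case: sgrP => h; lia.
have le j : (absz (x 0%R j - y' 0%R j)%R <= absz (x 0%R j - y 0%R j)%R)%N.
  by rewrite y'E; case: eqVneq => [->|//]; move: xyi; lia.
have enorm_y' : enorm R (x - y') <= enorm R (x - y).
  apply: enorm_le => j; have subE (u v : Zd) : (u - v) 0 j = u 0 j - v 0 j.
    by rewrite !mxE.
  by rewrite !subE; have := le j; lia.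
have [y'W|y'W] := boolP (y' \in W).
  exists y' => //.
  split=> //; exists y; split=> //.
  rewrite /enorm (bigD1 i) //= big1 ?addr0; last first.
    by move=> j /negPf ji; rewrite !mxE ji subrr expr0n.
  rewrite !mxE eqxx addrAC subrr add0r.
  by rewrite -rmorphXn /= sqr_sg subr_eq0 xyi rmorph1 sqrtr1.
have [|z zW zy'] := IH y' _ xW y'W.
  apply: leq_trans yn; rewrite (bigD1 i) //= [leqRHS](bigD1 i) //=.
  rewrite -addSn leq_add //.
  exact: leq_sum.
by exists z => //; exact: le_trans zy' enorm_y'.
Qed.

Variable g : Zd -> R.
Hypothesis g0 : forall x, 0 <= g x.
Hypothesis gfin : (\esum_(x in [set: Zd]) (g x)%:E < +oo)%E.

(** Bounds the error made when row x of the Toeplitz matrix on [W] replaces the full Fourier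
    series. *)
Definition wtail (W : {fset Zd}) (x : Zd) : R :=
  rtail g [fset y - x | y in W]%fset.

Lemma notin_dilation (A : set Zd) (r : R) (x z : Zd) :
  ~ dilation A r x -> A z -> r <= enorm R (x - z).
Proof.
move=> xA Az; rewrite leNgt; apply/negP => xz; apply: xA.
apply: le_lt_trans (_ : (enorm R (x - z))%:E < r%:E)%E; last by rewrite lte_fin.
by apply: ereal_inf_lbound; exists z.
Qed.

(** If x + z left [W] for some z in [F], a boundary point would lie within the norm of z, hence
    closer than r to x. So [F] is contained in W - x. *)
Lemma wtail_le_tail (W F : {fset Zd}) (r : R) x : x \in W ->
  (forall z, z \in F -> enorm R z < r) ->
  ~ dilation (boundary R W) r x -> wtail W x <= rtail g F.
Proof.
move=> xW Fr xr; apply: rtail_le => // z zF.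
have [xzW|xzW] := boolP (x + z \in W).
  by apply/imfsetP; exists (x + z) => //; rewrite addrC addKr.
have [w wW] := boundary_exit xW xzW.
rewrite opprD addrA subrr add0r enormN leNgt => /negP[].
by apply: lt_le_trans (Fr z zF) _; exact: notin_dilation wW.
Qed.

(** Points close to the boundary are charged the total mass [rtail g fset0], all others only the
    tail outside [F]. *)
Lemma sum_wtail_le (W F : {fset Zd}) (r : R) :
  (forall z, z \in F -> enorm R z < r) ->
  \sum_(x <- W) wtail W x
  <= #|` window (dilation (boundary R W) r) W|%:R * rtail g fset0
     + #|` W|%:R * rtail g F.
Proof.
move=> Fr; set D := dilation _ _.
have tF A : 0 <= rtail g A by exact: rtail_ge0.
apply: (@le_trans _ _ (\sum_(x <- W | `[< D x >]) rtail g fset0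
  + \sum_(x <- W | ~~ `[< D x >]) rtail g F)).
  rewrite (bigID (fun x => `[< D x >])) /=; apply: lerD.
    by apply: ler_sum => x _; exact: rtail_le.
  rewrite big_seq_cond [leRHS]big_seq_cond.
  apply: ler_sum => x /andP[xW /asboolPn xD].
  exact: wtail_le_tail xD.
have sumE (P : pred Zd) (c : R) : 0 <= c ->
    \sum_(x <- W | P x) c = (size [seq x <- W | P x])%:R * c.
  move=> c0; rewrite -big_filter big_const_seq count_predT iter_addr_0.
  by rewrite mulr_natl.
rewrite !sumE //; apply: lerD; rewrite ler_wpM2r // ler_nat; last first.
  by rewrite size_filter count_size.
rewrite uniq_leq_size ?filter_uniq ?fset_uniq // => x.
by rewrite mem_filter => /andP[Dx xW]; rewrite !inE /= xW.
Qed.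

End boundary.

(** * The estimate on one window *)

Section principal_submatrix.
Variables (R : realType) (k n : nat) (s : 'I_k -> 'I_n).
Hypothesis sI : injective s.

Lemma psd_mxsub (D : 'M[R]_n) : psd D -> psd (mxsub s s D).
Proof.
move=> hD v; pose E : 'M[R]_(k, n) := rowsub s 1%:M.
have -> : mxsub s s D = E *m D *m E^T.
  apply/matrixP => i j; rewrite !mxE (bigD1 (s j)) //= big1 ?addr0; last first.
    by move=> l lj; rewrite !mxE eq_sym (negPf lj) mulr0.
  rewrite !mxE eqxx mulr1 (bigD1 (s i)) //= big1 ?addr0; last first.
    by move=> l li; rewrite !mxE eq_sym (negPf li) mul0r.
  by rewrite !mxE eqxx mul1r.
have := hD (v *m E).
by rewrite !trqf trmx_mul !mulmxA.
Qed.

Lemma mxsub_scalar (a : R) : mxsub s s a%:M = a%:M.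
Proof. by apply/matrixP => i j; rewrite !mxE (inj_eq sI). Qed.

Lemma psd_diag_ge0 (D : 'M[R]_n) i : psd D -> 0 <= D i i.
Proof.
move=> /(_ (delta_mx 0 i)); rewrite trmx_delta mul_delta_mx.
rewrite mxtrace_mulC /mxtrace (bigD1 i) //= big1 ?addr0; last first.
  move=> j ji; rewrite mxE big1 // => l _.
  by rewrite mxE (negPf ji) andbF mulr0.
rewrite mxE (bigD1 i) //= big1 ?addr0; last first.
  by move=> l li; rewrite mxE (negPf li) mulr0.
by rewrite mxE !eqxx mulr1.
Qed.

(** The diagonal entries of [D] are nonnegative, and injectivity of [s] means that none is counted
    twice. *)
Lemma tr_mxsub_le (D : 'M[R]_n) : psd D -> \tr (mxsub s s D) <= \tr D.
Proof.
move=> hD; rewrite /mxtrace.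
rewrite (eq_bigr (fun i => D (s i) (s i))) => [|i _]; last by rewrite mxE.
rewrite -(big_map s xpredT (fun j => D j j)) /=.
rewrite -[leRHS]big_enum -[X in map s X]enumT.
apply: ler_sum_subset => //.
- by move=> i; exact: psd_diag_ge0.
- by rewrite map_inj_uniq ?enum_uniq.
- by rewrite enum_uniq.
- by move=> j _; rewrite mem_enum.
Qed.

End principal_submatrix.

Section window_estimate.
Variables (R : realType) (d : nat).
Local Notation Zd := 'rV[int]_d.
Variables (g : Zd -> R) (m M : R).
Hypothesis gfin : (\esum_(x in [set: Zd]) (g x)%:E < +oo)%E.
Hypotheses (m0 : 0 < m) (M1 : M < 1).
Variables (K0 : Zd -> R).
Hypothesis K0g : forall z, `|K0 z| <= g z.
Hypothesis K0N : forall z, K0 (- z) = K0 z.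
Hypothesis ck : continuous (@khat R d K0).
Hypothesis kmM : forall t, m <= khat K0 t <= M.

Let g0 z : 0 <= g z. Proof. exact: le_trans (normr_ge0 _) (K0g z). Qed.

Let beta0 : 0 < 1 - M. Proof. by rewrite subr_gt0. Qed.

Variables (W : {fset Zd}) (A : set Zd).
Let n := #|` W|.
Let x (i : 'I_n) : Zd := tnth (in_tuple (enum_fset W)) i.
Let b (t : 'rV[R]_d) := 1 - khat K0 t.
Let c t := (b t)^-1.

Let xI : injective x.
Proof. by apply/tuple_uniqP; exact: fset_uniq. Qed.

Let cb : continuous b.
Proof. by apply: continuous_realB => //; exact: continuous_real_cst. Qed.

Let b_ge t : 1 - M <= b t.
Proof. by case/andP: (kmM t) => _ h; rewrite lerB. Qed.

Let b_gt0 t : 0 < b t. Proof. exact: lt_le_trans beta0 (b_ge t). Qed.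

Let b_le t : b t <= 1 - m.
Proof. by case/andP: (kmM t) => h _; rewrite lerB. Qed.

Let cc : continuous c.
Proof. by apply: continuous_realV => // t; rewrite gt_eqF. Qed.

Lemma submat_window : 1%:M - submat (stat_kernel K0) W = toep x b.
Proof. by rewrite (toep_1B_khat gfin K0g K0N ck xI). Qed.

(** With K = 1 - T, one has K (1 - K)^-1 = T^-1 - 1. *)
Lemma L_windowE :
  L_window (stat_kernel K0) W = mat_kernel (invmx (toep x b) - 1%:M).
Proof.
rewrite /L_window submat_window; congr mat_kernel.
have -> : submat (stat_kernel K0) W = 1%:M - toep x b.
  by rewrite -submat_window subKr.
by rewrite mulmxBl mul1mx mulmxV //; exact: toep_unit beta0 b_ge.
Qed.

Lemma L0E z :
  L0 K0 z = cube_integral (fun t => (c t - 1) * cos (2 * pi * dot z t)).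
Proof.
rewrite /L0 /ccube_integral /=; apply: cube_integral_ext => t /=.
rewrite mul0r subr0; congr (_ * _); rewrite /c /b.
by field; rewrite gt_eqF // b_gt0.
Qed.

Let Y := window A W.

Let YW y : y \in Y -> y \in W.
Proof. by rewrite !inE /= => /andP[]. Qed.

(** Presents matrices indexed by [Y] as principal submatrices of matrices indexed by [W]. *)
Let sigma (i : 'I_#|` Y|) : 'I_n :=
  Ordinal (etrans (index_mem _ (enum_fset W))
    (YW (mem_tnth i (in_tuple (enum_fset Y))))).

Let x_sigma i : x (sigma i) = tnth (in_tuple (enum_fset Y)) i.
Proof.
rewrite /x (tnth_nth 0) /= nth_index //.
exact: YW (mem_tnth i (in_tuple (enum_fset Y))).
Qed.

Let sigmaI : injective sigma.
Proof.
move=> i j /(congr1 x); rewrite !x_sigma.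
by apply/tuple_uniqP; exact: fset_uniq.
Qed.

Lemma submat_mat_kernel (L : 'M[R]_n) :
  submat (mat_kernel L) Y = mxsub sigma sigma L.
Proof.
apply/matrixP => i j; rewrite !mxE /mat_kernel.
have insE l : insub (index (tnth (in_tuple (enum_fset Y)) l) (enum_fset W))
    = Some (sigma l) :> option 'I_n.
  rewrite insubT ?index_mem ?YW ?mem_tnth // => h.
  by congr Some; exact: val_inj.
by rewrite !insE.
Qed.

Lemma submat_L0 :
  submat (stat_kernel (L0 K0)) Y = mxsub sigma sigma (toep x c - 1%:M).
Proof.
have c1 := @continuous_real_cst R 'rV[R]_d 1.
have -> : toep x c - 1%:M = toep x (fun t => c t - 1).
  rewrite -(toep_cst _ xI); apply/eqP; rewrite subr_eq; apply/eqP.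
  rewrite -toepD //; last exact: continuous_realB.
  by congr (toep x); apply/funext => t; rewrite subrK.
apply/matrixP => i j; rewrite !mxE /stat_kernel L0E -!x_sigma.
apply: cube_integral_ext => t.
by rewrite -[x (sigma i) - _]opprB dotN mulrN cosN.
Qed.

(** With e the sum of the [wtail], the gap in [szego] contributes e / (1 - M). Comparing the
    determinants on [Y] contributes e / ((1 - M)^2 m): one more factor 1 / (1 - M) comes from
    [tr_toepB_inv], and 1 / m from [logdet_compare]. *)
Lemma window_estimate : (0 < n)%N ->
  `|approx_loglik K0 W A - loglik (stat_kernel K0) W A|
  <= n%:R^-1 * ((1 - M)^-1 * (1 + ((1 - M) * m)^-1)
                * \sum_(z <- W) wtail g W z).
Proof.
move=> n0.
set e := \sum_(z <- W) _.
have sz := szego xI cb beta0 b_ge.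
set T := toep x b in sz *; set C := toep x c in sz *.
have trE : \tr (T *m C) - n%:R <= e / (1 - M).
  have -> : e = \sum_(i < n) wtail g W (x i) by rewrite /e big_tnth.
  apply: (tr_toepM_le cb beta0 b_ge) => i t.
  apply: le_trans (toep_symbol_close gfin K0g K0N ck xI i t) _.
  apply: (rtail_le g0) => z /imfsetP[y /= yW ->].
  have yW' : (index y (enum_fset W) < n)%N by rewrite index_mem.
  have xy : x (Ordinal yW') = y by rewrite /x (tnth_nth 0) /= nth_index.
  by apply/imfsetP; exists (Ordinal yW'); rewrite ?xy.
have linsub (B B' : 'M[R]_n) :
    mxsub sigma sigma B - mxsub sigma sigma B' = mxsub sigma sigma (B - B').
  by apply/matrixP => i j; rewrite !mxE.
have D0 : psd (C - invmx T) := psd_toepB_inv xI cb beta0 b_ge.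
have trD : \tr (C - invmx T) <= e / (1 - M) / (1 - M).
  apply: le_trans (tr_toepB_inv xI cb beta0 b_ge) _.
  by rewrite ler_pM2r ?invr_gt0.
have Tsym : (invmx T)^T = invmx T by rewrite trmx_inv toep_sym.
pose LW := mxsub sigma sigma (invmx T - 1%:M).
pose LC := mxsub sigma sigma (C - 1%:M).
have LWsym : LW^T = LW by rewrite trmx_mxsub linearB /= trmx1 Tsym.
have LCsym : LC^T = LC by rewrite trmx_mxsub linearB /= trmx1 toep_sym.
(* Since b <= 1 - m, the inverse of T is at least 1 + m; subtracting the identity leaves m. *)
have mLW : psd (LW - m%:M).
  rewrite -(mxsub_scalar sigmaI) linsub; apply: psd_mxsub.
  rewrite -addrA -opprD (_ : 1%:M + m%:M = (1 + m)%:M); last by rewrite raddfD.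
  exact: (psd_invmx_toep_ge xI cb beta0 b_ge b_le).
have LCW : LC - LW = mxsub sigma sigma (C - invmx T).
  by rewrite linsub opprB addrA subrK.
have psdLCW : psd (LC - LW) by rewrite LCW; exact: psd_mxsub.
have cmp : 0 <= ln (\det LC) - ln (\det LW) <= e / (1 - M) / (1 - M) / m.
  have /andP[-> h] := logdet_compare m0 LWsym LCsym mLW psdLCW.
  apply: le_trans h _; rewrite LCW ler_pM2r ?invr_gt0 //.
  exact: le_trans (tr_mxsub_le sigmaI D0) trD.
rewrite /approx_loglik /loglik -/Y submat_L0 L_windowE submat_mat_kernel.
rewrite submat_window -/n -/T -/C -/LW -/LC.
move: sz cmp; set I := cube_integral _; set l1 := ln _.
set l2 := ln _; set l3 := ln _ => /andP[s1 s2] /andP[c1 c2].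
have nR : 0 < n%:R :> R by rewrite ltr0n.
(* The difference is the determinant gap on [Y] minus the gap of [szego]. Both are nonnegative, so
   either upper bound controls one sign. *)
rewrite (_ : _ - _ = n%:R^-1 * ((l2 - l3) - (l1 - n%:R * I))); last first.
  by field; rewrite gt_eqF.
rewrite normrM gtr0_norm ?invr_gt0 // ler_pM2l ?invr_gt0 //.
apply: (@le_trans _ _ (e / (1 - M) + e / (1 - M) / (1 - M) / m)).
  by rewrite ler_norml; lra.
rewrite le_eqVlt; apply/orP; left; apply/eqP.
by field; rewrite !gt_eqF.
Qed.

End window_estimate.

(** * Uniform convergence *)

(** The image of [K] is compact, hence closed, and misses 0; so it misses a ball around 0, whose
    radius serves as m. *)
Lemma compact_min_pos (R : realType) (T : topologicalType) (f : T -> R)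
    (K : set T) : compact K -> {within K, continuous f} ->
  (forall x, K x -> 0 < f x) -> exists2 m, 0 < m & forall x, K x -> m <= f x.
Proof.
move=> cK cf f0.
have clK : closed (f @` K).
  by apply: compact_closed; [exact: Rhausdorff|exact: continuous_compact].
have : nbhs (0 : R) (~` (f @` K)).
  apply: open_nbhs_nbhs; split; first exact: closed_openC.
  by move=> -[x Kx /eqP]; rewrite gt_eqF ?f0.
move=> /nbhs_ballP[m /= m0 hm]; exists m => // x Kx.
rewrite leNgt; apply/negP => fm.
apply: (hm (f x)); last by exists x.
by rewrite /ball /= sub0r normrN gtr0_norm ?f0.
Qed.

Lemma compact_unit_cube (R : realType) d : compact (@unit_cube R d).
Proof.
have := @rV_compact R d (fun=> `[(0 : R), 1]%classic)
  (fun=> @segment_compact R 0 1).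
by congr compact; apply/seteqP; split=> t /= h i; have := h i;
  rewrite /= in_itv.
Qed.

Lemma within_section (T U V : topologicalType) (A : set T) (f : T * U -> V) a :
  {within A `*` [set: U], continuous f} -> A a ->
  continuous (fun u => f (a, u)).
Proof.
move=> /subspace_continuousP cf Aa u B.
move=> /(cf (a, u) (conj Aa I)) [[P Q] /= [aP uQ] PQ].
apply: filterS uQ => v Qv.
by apply: (PQ (a, v)); split=> //=; exact: nbhs_singleton aP.
Qed.

Section wtail_average.
Variables (R : realType) (d : nat) (g : 'rV[int]_d -> R).
Variable W : nat -> {fset 'rV[int]_d}.
Hypothesis g0 : forall z, 0 <= g z.
Hypothesis gfin : (\esum_(x in [set: 'rV[int]_d]) (g x)%:E < +oo)%E.
Variable r : nat -> R.
Hypothesis W_gt0 : \forall n \near \oo, (0 < #|` W n|)%N.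
Hypothesis r_infty : r @ \oo --> +oo.
Hypothesis W_bdry :
  (fun n => #|` window (dilation (boundary R (W n)) (r n)) (W n)|%:R : R^o)
  =o_\oo (fun n => #|` W n|%:R : R^o).

(** A finite set [F] leaves a tail below e / 2. Once [r n] exceeds every norm in [F], [sum_wtail_le]
    applies, and the boundary layer contributes at most e / 2 per point of the window because it is
    a vanishing fraction of it. *)
Lemma wtail_average_cvg0 :
  (fun n => #|` W n|%:R^-1 * \sum_(z <- W n) wtail g (W n) z) @ \oo --> (0 : R).
Proof.
apply/cvgrPdist_le => e e0; set S := rtail g fset0.
have S0 : 0 <= S by exact: rtail_ge0.
(* [S] may vanish, so [S + 1] is used as the divisor below. *)
have S1 : 0 < S + 1 by rewrite ltr_wpDl.
have e2 : 0 < e / 2 by rewrite divr_gt0.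
have [F Fe] := rtail_small g0 gfin e2.
(* The sum of the norms dominates each of them, and the added 1 makes the inequality strict. *)
have Fr : \forall n \near \oo, \sum_(z <- F) enorm R z + 1 <= r n.
  by move/cvgryPge : r_infty; exact.
have := W_bdry => /eqoP/(_ (e / 2 / (S + 1)) (divr_gt0 e2 S1)) Wb.
near=> n.
have n0 : 0 < #|` W n|%:R :> R by rewrite ltr0n; near: n.
have rn : forall z, z \in F -> enorm R z < r n.
  move=> z zF; apply: (@lt_le_trans _ _ (\sum_(z <- F) enorm R z + 1)).
    rewrite (bigD1_seq z) ?fset_uniq //= -addrA ltrDl ltr_wpDl // sumr_ge0 //.
    by move=> *; exact: enorm_ge0.
  by near: n.
have wn : #|` window (dilation (boundary R (W n)) (r n)) (W n)|%:R
    <= e / 2 / (S + 1) * #|` W n|%:R.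
  have : `|#|` window (dilation (boundary R (W n)) (r n)) (W n)|%:R : R^o|
    <= e / 2 / (S + 1) * `|#|` W n|%:R : R^o| by near: n.
  by rewrite !ger0_norm.
have sum0 : 0 <= \sum_(z <- W n) wtail g (W n) z.
  by apply: sumr_ge0 => z _; exact: rtail_ge0.
rewrite sub0r normrN ger0_norm; last by rewrite mulr_ge0 // invr_ge0 ltW.
rewrite mulrC ler_pdivrMr //;
apply: le_trans (sum_wtail_le g0 gfin (W n) rn) _.
rewrite -/S [e]splitr mulrDl; apply: lerD; last first.
  by rewrite mulrC ler_pM2r // ltW.
apply: (@le_trans _ _ (e / 2 / (S + 1) * #|` W n|%:R * S)).
  by rewrite ler_wpM2r.
rewrite (_ : _ * S = e / 2 * #|` W n|%:R * (S / (S + 1))); last first.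
  by field; rewrite gt_eqF.
rewrite ler_piMr ?mulr_ge0 // ?ler_pdivrMr //; lra.
Unshelve. all: by end_near. Qed.

End wtail_average.

Theorem corollary3p3 (R : realType) (d : nat) (hd : (0 < d)%N)
  (W : nat -> {fset 'rV[int]_d})
  (W_incr : forall n, (W n `<=` W n.+1)%fset)
  (W_cover : forall x, exists n, x \in W n)
  (W_bdry : exists r : nat -> R,
     [/\ forall n, 0 <= r n,
         {homo r : m n / (m <= n)%N >-> m <= n},
         r @ \oo --> +oo
       & (fun n => #|` window (dilation (boundary R (W n)) (r n)) (W n)|%:R : R^o)
           =o_\oo (fun n => #|` W n|%:R : R^o)])
  (W_sum : forall delta : R, 0 < delta ->
     (\sum_(0 <= n <oo) (expR (- delta * #|` W n|%:R))%:E < +oo)%E)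
  (p : nat) (hp : (0 < p)%N)
  (Theta : set 'rV[R]_p) (Theta_compact : compact Theta)
  (K0 : 'rV[R]_p -> 'rV[int]_d -> R)
  (K0_dpp : forall theta, Theta theta -> dpp_kernel (stat_kernel (K0 theta)))
  (khat_cont : {within Theta `*` [set: 'rV[R]_d],
     continuous (fun q : 'rV[R]_p * 'rV[R]_d => khat (K0 q.1) q.2)})
  (A tau M : R) (A_gt0 : 0 < A) (tau_gt0 : 0 < tau) (M_lt1 : M < 1)
  (K0_decay : forall theta, Theta theta -> forall x,
     `|K0 theta x| <= A / (1 + enorm R x `^ (d%:R + tau)))
  (khat_bound : forall theta, Theta theta -> forall x, unit_cube x ->
     0 < khat (K0 theta) x <= M)
  (theta_star : 'rV[R]_p) (theta_star_in : Theta theta_star)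
  (disp : measure_display) (Omega : measurableType disp)
  (P : probability Omega R) (X : Omega -> set 'rV[int]_d)
  (X_dpp : is_dpp P X (stat_kernel (K0 theta_star))) :
  {ae P, forall w,
    (fun n => ereal_sup
       [set (`|approx_loglik (K0 theta) (W n) (X w)
               - loglik (stat_kernel (K0 theta)) (W n) (X w)|)%:E
        | theta in Theta]) @ \oo --> 0%E}.
Proof.
apply: aeW => w.
case: W_bdry => r [r0 rhomo rinf rb].
set g := fun z : 'rV[int]_d => A / (1 + enorm R z `^ (d%:R + tau)).
have gfin : (\esum_(z in [set: 'rV[int]_d]) (g z)%:E < +oo)%E.
  exact: decay_summable.
have g0 z : 0 <= g z.
  exact: le_trans (normr_ge0 _) (K0_decay _ theta_star_in z).
have khat_pos : forall q, (Theta `*` @unit_cube R d) q -> 0 < khat (K0 q.1) q.2.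
  by move=> [th t] /= [hth ht]; case/andP: (khat_bound _ hth _ ht).
(* Compactness of the product of [Theta] and the cube makes the lower bound on the symbol uniform in
   theta. *)
have [m m0 hm] : exists2 m, 0 < m & forall q, (Theta `*` @unit_cube R d) q ->
    m <= khat (K0 q.1) q.2.
  apply: (compact_min_pos _ _ khat_pos).
    exact: compact_setX Theta_compact (@compact_unit_cube R d).
  by apply: continuous_subspaceW khat_cont => -[th t] [].
(* Some window contains the origin, and so do all later ones. *)
have W_gt0 : \forall n \near \oo, (0 < #|` W n|)%N.
  have [n0 hn0] := W_cover 0.
  exists n0 => // n /= n0n; rewrite cardfs_gt0; apply/fset0Pn; exists 0.
  elim: n n0n => [|n IH].
    by rewrite leqn0 => /eqP n0E; rewrite n0E in hn0.
  rewrite leq_eqVlt => /predU1P[n0E|]; first by rewrite n0E in hn0.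
  by rewrite ltnS => /IH; exact/fsubsetP.
pose C := (1 - M)^-1 * (1 + ((1 - M) * m)^-1).
pose e n := C * (#|` W n|%:R^-1 * \sum_(z <- W n) wtail g (W n) z).
apply: (@squeeze_cvge _ _ _ _ (cst 0%E) _ (fun n => (e n)%:E)).
- near=> n; apply/andP; split.
    (* The term at [theta_star] keeps the supremum nonnegative; over an empty family it would be
       -oo. *)
    apply: le_trans (ereal_sup_ubound _); last by exists theta_star.
    by rewrite lee_fin.
  apply: ge_ereal_sup => _ [th hth <-]; rewrite lee_fin.
  rewrite /e mulrCA.
  apply: (window_estimate gfin m0 M_lt1).
  + exact: K0_decay.
  (* Symmetry of the kernel at the pair (z, 0) says that [K0 th] is even. *)
  + move=> z; have [/(_ z 0) + _ _] := K0_dpp _ hth.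
    by rewrite /stat_kernel subr0 sub0r.
  + exact: (within_section khat_cont hth).
  + apply: khat_bounds => t ht; rewrite (hm (th, t)) //.
    by case/andP: (khat_bound _ hth _ ht).
  + by near: n.
- exact: cvg_cst.
- apply: cvg_EFin; first exact: nearW.
  rewrite -[X in _ --> X](mulr0 C); apply: cvgMl_tmp.
  exact: wtail_average_cvg0 rb.
Unshelve. all: by end_near. Qed.
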